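(* Let $\varepsilon\in\mathbb{R}$ with $0\leq\varepsilon\leq\frac16$ and define $f_\varepsilon:\mathbb{N}\to[0,1]$ by \[ f_\varepsilon(d)=\begin{cases}1 & \text{if } d=0,\\ 1-\varepsilon & \text{if } d=1,\\ \frac23 & \text{if } d=2,\\ \min\left\{3\varepsilon,\frac{2}{d+1}\right\} & \text{if } d\geq 3.\end{cases} \] Then $\alpha_{\mathcal{L}}(G)\geq \sum_{v\in V(G)} f_\varepsilon(d_G(v))$ holds for every graph $G$. Moreover, this lower bound $f_\varepsilon$ for $\alpha_{\mathcal{L}}$ is extremal, and every lower bound for $\alpha_{\mathcal{L}}$ is dominated by some lower bound of this form (i.e. by $f_{\varepsilon}$ for some $\varepsilon$ with $0\leq\varepsilon\leq\frac16$).
   Context: All graphs are finite, simple, and undirected; $d_G(v)$ denotes the degree of vertex $v$ in $G$; $\mathbb{N}$ includes $0$. A forest is linear if every connected component of it is a path, where a single vertex is considered to be a path. $\mathcal{L}$ denotes the set of all linear forests. Given a class of graphs $\mathcal{C}$ and a graph $G$, $\alpha_{\mathcal{C}}(G)$ denotes the maximum number of vertices of an induced subgraph $H$ of $G$ such that $H$ belongs to $\mathcal{C}$. A function $f:\mathbb{N}\to[0,1]$ is called a lower bound for $\alpha_{\mathcal{C}}$ if $\alpha_{\mathcal{C}}(G)\geq\sum_{v\in V(G)} f(d_G(v))$ holds for all graphs $G$. Such a lower bound $f$ is extremal if there does not exist $g:\mathbb{N}\to[0,1]$ with $g\not\equiv 0$ such that $f+g$ is also a lower bound for $\alpha_{\mathcal{C}}$.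 A lower bound $f$ is dominated by a lower bound $f'$ if $f(d)\leq f'(d)$ holds for every $d\in\mathbb{N}$. *)

(* Defs.v *)
From mathcomp Require Import all_boot all_order all_algebra.
From mathcomp Require Import boolp reals.

Set Implicit Arguments.
Unset Strict Implicit.
Unset Printing Implicit Defensive.

Import Order.TTheory GRing.Theory Num.Theory.

Record sgraph := SGraph {
  vertex :> finType;
  edge : rel vertex;
  edge_sym : symmetric edge;
  edge_irrefl : irreflexive edge
}.

Definition deg (G : sgraph) (v : G) : nat := #|[set w : G | edge v w]|.

Definition isomorphic (G H : sgraph) : Prop :=
  exists2 f : G -> H, bijective f & forall x y, edge (f x) (f y) = edge x y.

Section Induced.
Variables (G : sgraph) (S : {set G}).

Definition induced_edge : rel {x : G | x \in S} :=
  fun x y => edge (val x) (val y).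

Lemma induced_edge_sym : symmetric induced_edge.
Proof. by move=> x y; apply: edge_sym. Qed.

Lemma induced_edge_irrefl : irreflexive induced_edge.
Proof. by move=> x; apply: edge_irrefl. Qed.

Definition induced : sgraph := SGraph induced_edge_sym induced_edge_irrefl.
End Induced.

Section PathGraph.
Variable n : nat.

Definition path_edge : rel 'I_n := fun i j => (i.+1 == j) || (j.+1 == i).

Lemma path_edge_sym : symmetric path_edge.
Proof. by move=> i j; rewrite /path_edge orbC. Qed.

Lemma path_edge_irrefl : irreflexive path_edge.
Proof. by move=> i; rewrite /path_edge orbb gtn_eqF. Qed.

Definition path_graph : sgraph := SGraph path_edge_sym path_edge_irrefl.
End PathGraph.

Definition is_path_graph (G : sgraph) : Prop :=
  exists n : nat, isomorphic G (path_graph n.+1).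

(* [ucycle] also accepts the empty cycle and the closed walk x, y, x along an
   edge, so genuine cycles are those with at least three vertices. *)
Definition is_forest (G : sgraph) : Prop :=
  forall c : seq G, ucycle (@edge G) c -> (size c < 3)%N.

Definition component (G : sgraph) (x : G) : {set G} :=
  [set y : G | connect (@edge G) x y].

Definition linear_forest (G : sgraph) : Prop :=
  is_forest G /\ forall x : G, is_path_graph (induced (component x)).

(* The maximum of an empty family is 0; this never occurs for linear forests,
   since the empty graph is one. *)
Definition alpha (C : sgraph -> Prop) (G : sgraph) : nat :=
  \max_(S : {set G} | `[< C (induced S) >]) #|S|.

Local Open Scope ring_scope.

Section LowerBounds.
Variable R : realType.
Implicit Types f g : nat -> R.

Definition unit_valued f : Prop := forall d, 0 <= f d <= 1.

Definition lower_bound (C : sgraph -> Prop) f : Prop :=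
  unit_valued f /\
  forall G : sgraph, \sum_(v : G) f (deg v) <= (alpha C G)%:R.

Definition extremal (C : sgraph -> Prop) f : Prop :=
  lower_bound C f /\
  ~ exists g, [/\ unit_valued g, exists d, g d <> 0 &
                  lower_bound C (fun d => f d + g d)].

Definition dominated f f' : Prop := forall d, f d <= f' d.

Definition f_eps (eps : R) (d : nat) : R :=
  match d with
  | 0%N => 1
  | 1%N => 1 - eps
  | 2%N => 2 / 3
  | _ => Num.min (3 * eps) (2 / (d%:R + 1))
  end.
End LowerBounds.

(* Main.v *)
Require Import Defs.
From mathcomp Require Import all_boot all_order all_algebra.
From mathcomp Require Import boolp reals.
From mathcomp Require Import zify ring lra.

(** The upper bounds come from two families of graphs.  A complete graph on
    [d.+1] vertices has no induced linear forest on three vertices, so that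
    [f d <= 2 / d.+1]; and a complete graph each of whose vertices carries three
    leaves, where an induced linear forest misses a vertex of every claw, gives
    [f d + 3 * f 1 <= 3] for [3 <= d].  Extremality and domination follow from
    these inequalities: [eps] is read off from [f 1].

    For the lower bound, take a smallest set [S] of vertices in which it fails.
    The only reduction is to keep a set [Y] in the forest, to discard the rest
    of a set [Z] that contains [Y] and its neighbours, and to recurse on
    [S :\: Z], where the degrees have dropped and the weights have risen.
    Pendant paths reduce, and so does a vertex of degree at least three with
    three neighbours of degree at most two, since each of these gains [eps].
    So all leaves can be kept: what remains is a graph whose vertices carry
    [l <= 2] leaves, and in which a forest is sought where such a vertex has at
    most [2 - l] neighbours.  When the leaves are counted in full, a vertex of
    degree [D] only has to contribute [f_eps eps D - l * eps], and this is at
    most [(1 - l / 3) * (2 / D.+1)] whatever [eps] is.  This makes [eps]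
    disappear ([f_eps_le_large], [f_eps_le_small]).

    The remaining problem is solved with weights that decrease like
    [c_l / d.+1] in the degree [d] among the surviving vertices, with
    [c_0 = 2].  A vertex minimising weight over degree can be deleted: the
    neighbours gain at least as much as it loses ([minimal_light]).  This only
    fails for small degrees, where the weights follow straight lines of a
    common slope [- m / N].  At that stage all degrees are small, the total
    weight is a linear function of the numbers of vertices and edges, and a
    reduction is verified by counting edges ([irreducible]).  A flat slope makes
    weights small and the local analysis easy, but is not sustainable down to
    the smallest degrees, so the slope is increased in stages.  With slope
    [1 / 18] the vertices with two leaves are eliminated ([no_twos_small]), with
    slope [1 / 9] those with one leaf ([no_ones]), and with slope [1 / 6] only
    paths and cycles remain, where a cycle of length [n] weighs
    [2 / 3 * n <= n - 1] ([attained_plain]).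

    If [1 / 12 <= eps], then vertices with two leaves need so little weight that
    one can start with slope [1 / 9].  If [eps <= 1 / 12], then a vertex of
    degree at least three with a neighbour of degree two can be deleted as well,
    and vertices of degree two do not interfere with the first stage. *)

Set Implicit Arguments.
Unset Strict Implicit.
Unset Printing Implicit Defensive.

Import Order.TTheory GRing.Theory Num.Theory.

(** * Acyclic sets of vertices *)

Section Degrees.
Variable G : sgraph.
Implicit Types (S C F Y Z : {set G}) (u v w x y z : G).

Definition nbs S v : {set G} := [set w in S | edge v w].
Definition dg S v : nat := #|nbs S v|.

Lemma in_nbs S v w : (w \in nbs S v) = (w \in S) && edge v w.
Proof. by rewrite inE. Qed.

Lemma edgeC v w : edge v w = edge w v. Proof. exact: edge_sym. Qed.

Lemma edgeN v : edge v v = false. Proof. exact: edge_irrefl. Qed.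

Lemma edge_neq v w : edge v w -> v != w.
Proof. by move=> evw; apply/eqP => vw; rewrite vw edgeN in evw. Qed.

Lemma sub_nbs S C v : S \subset C -> nbs S v \subset nbs C v.
Proof.
move=> /subsetP sSC; apply/subsetP => w; rewrite !in_nbs => /andP[/sSC-> //].
Qed.

Lemma leq_dg S C v : S \subset C -> (dg S v <= dg C v).
Proof. by move=> sSC; apply: subset_leq_card; apply: sub_nbs. Qed.

Lemma dgE S v : dg S v = (\sum_(w in S) edge v w).
Proof.
rewrite /dg -sum1_card (eq_bigl (fun w => (w \in S) && edge v w)); last first.
  by move=> w; rewrite in_nbs.
by rewrite big_mkcondr; apply: eq_bigr => w _; case: (edge v w).
Qed.

Lemma dg_seq (s : seq G) v : uniq s -> dg [set x in s] v = count (edge v) s.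
Proof.
move=> us; rewrite dgE (eq_bigl (mem s)); last by move=> w; rewrite inE.
rewrite -(big_uniq _ us) -sum1_count [RHS]big_mkcond.
by apply: eq_bigr => w _; case: edge.
Qed.

Lemma leq_count_dg S (s : seq G) v :
  uniq s -> {subset s <= S} -> (count (edge v) s <= dg S v).
Proof.
move=> us sS; rewrite -dg_seq //; apply: leq_dg.
by apply/subsetP => x; rewrite inE => /sS.
Qed.

Lemma dgD S Z v : Z \subset S -> dg S v = (dg Z v + dg (S :\: Z) v).
Proof.
move=> sZS; rewrite !dgE (big_setID Z) /=; congr (_ + _).
by apply: eq_bigl => w; rewrite inE andbC; case: (boolP (w \in Z)) => // /(subsetP sZS)->.
Qed.

Lemma dg_setD1 S u v : u \in S -> dg S v = (edge v u + dg (S :\ u) v).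
Proof. by move=> uS; rewrite !dgE (big_setD1 u). Qed.

(** 1-degeneracy, equivalent to the absence of cycles in the graph induced on
    [F]; unlike the latter, it passes to disjoint unions and pendant extensions
    without any manipulation of walks. *)
Definition acyclic F : Prop :=
  forall C, C \subset F -> C != set0 -> exists2 v, v \in C & (dg C v <= 1).

Variable cap : G -> nat.

Definition admissible F : Prop :=
  (forall v, v \in F -> (dg F v <= cap v)) /\ acyclic F.

Lemma admissible0 : admissible set0.
Proof.
split=> [v|C]; first by rewrite inE.
by rewrite subset0 => /eqP-> /eqP.
Qed.

Lemma dg_setU S C v : {in C, forall w, edge v w = false} -> dg (S :|: C) v = dg S v.
Proof.
move=> nC; rewrite /dg; congr #|pred_of_set _|; apply/setP => w; rewrite !in_nbs inE.
by case: (boolP (w \in C)) => [/nC->|_]; rewrite ?andbF ?orbF.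
Qed.

Lemma acyclicU F Y :
  acyclic F -> acyclic Y -> {in F & Y, forall u v, edge u v = false} ->
  acyclic (F :|: Y).
Proof.
move=> aF aY nFY C sC C0.
have [CF0|CF0] := eqVneq (C :&: F) set0.
  apply: aY => //; apply/subsetP => x xC.
  have := subsetP sC x xC; rewrite inE => /orP[xF|//].
  by have := in_set0 x; rewrite -CF0 inE xC xF.
have [v vCF dv] := aF _ (subsetIr C F) CF0; exists v; first by case/setIP: vCF.
suff -> : dg C v = dg (C :&: F) v by [].
have -> : C = (C :&: F) :|: (C :\: F) by rewrite setID.
rewrite setIUl -setIA setIid (_ : (C :\: F) :&: F = set0); last first.
  by apply/setP => x; rewrite !inE; case: (x \in F); rewrite ?andbF.
rewrite setU0; apply: dg_setU => w; rewrite inE => /andP[wF wC].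
case/setIP: vCF => _ vF; apply: nFY => //.
by have := subsetP sC w wC; rewrite inE (negPf wF).
Qed.

Lemma admissibleU F Y :
  admissible F -> admissible Y -> {in F & Y, forall u v, edge u v = false} ->
  admissible (F :|: Y).
Proof.
move=> [cF aF] [cY aY] nFY; split; last exact: acyclicU.
move=> v; rewrite inE => /orP[vF|vY].
  by rewrite dg_setU ?cF // => w wY; apply: nFY.
by rewrite setUC dg_setU ?cY // => w wF; rewrite edgeC; apply: nFY.
Qed.

Lemma acyclic_pendant F v : acyclic F -> (dg F v <= 1) -> acyclic (v |: F).
Proof.
move=> aF dv C sC C0; have [vC|vC] := boolP (v \in C).
  exists v => //; apply: leq_trans dv.
  rewrite -(setD1K vC) /dg; apply: subset_leq_card; apply/subsetP => w.
  rewrite !in_nbs => /andP[wC evw]; rewrite evw andbT.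
  have wv : w != v by rewrite eq_sym edge_neq.
  move: wC; rewrite !inE (negPf wv) /= => wC.
  by have := subsetP sC w wC; rewrite !inE (negPf wv).
apply: aF => //; apply/subsetP => x xC; have := subsetP sC x xC.
by rewrite !inE => /orP[/eqP xv|//]; rewrite -xv xC in vC.
Qed.

(** The short paths that the reductions keep are built with this lemma, one
    end vertex at a time. *)
Lemma admissible_extend F u v :
  admissible F -> v \notin F -> u \in F ->
  {in F, forall w, w != u -> edge v w = false} ->
  (dg F u < cap u) -> (0 < cap v) -> admissible (v |: F).
Proof.
move=> [cF aF] vF uF nv du capv.
have dv : (dg F v <= 1).
  rewrite /dg -(cards1 u); apply: subset_leq_card; apply/subsetP => w.
  rewrite in_nbs inE => /andP[wF evw]; apply/negPn/negP => /(nv w wF).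
  by rewrite evw.
have dvF w : dg (v |: F) w = (edge w v + dg F w).
  by rewrite (dg_setD1 _ (setU11 _ _)) setU1K.
split; last exact: acyclic_pendant.
move=> w; rewrite dvF !inE => /orP[/eqP->|wF]; first by rewrite edgeN; lia.
have [->|wu] := eqVneq w u; first by case: edge => /=; lia.
by rewrite edgeC nv // add0n cF.
Qed.

Lemma admissible1 v : admissible [set v].
Proof.
have d0 : dg [set v] v = 0.
  by apply/eqP; rewrite cards_eq0; apply/eqP/setP => w; rewrite in_nbs !inE;
     case: eqVneq => // ->; rewrite edgeN.
split=> [w|C sC C0]; first by rewrite inE => /eqP->; rewrite d0.
have /eqP -> : C == [set v] by have := sC; rewrite subset1 (negPf C0) orbF.
by exists v; rewrite ?inE ?d0.
Qed.

End Degrees.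

(** * Linear forests *)

Section Transfer.
Variables (G : sgraph) (S : {set G}).
Implicit Types (C : {set induced S}) (x : induced S).

Lemma dg_induced C x : dg (val @: C) (val x) = dg C x.
Proof.
rewrite /dg -(card_imset (mem (nbs C x)) val_inj).
congr #|pred_of_set _|; apply/setP => w; rewrite in_nbs.
apply/andP/imsetP => [[/imsetP[y yC ->] exy]|[y]].
  by exists y => //; rewrite in_nbs yC.
by rewrite in_nbs => /andP[yC exy] ->; rewrite imset_f.
Qed.

Lemma val_induced C : val @: C \subset S.
Proof. by apply/subsetP => _ /imsetP[y _ ->]; apply: valP. Qed.

Lemma acyclic_induced : acyclic S -> acyclic [set: induced S].
Proof.
move=> aS C _ C0; have [||v /imsetP[y yC ->] dv] := aS (val @: C).
- exact: val_induced.
- by rewrite imset_eq0.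
by exists y; rewrite // -dg_induced.
Qed.

Lemma dg_inducedT x : dg [set: induced S] x = dg S (val x).
Proof.
rewrite -dg_induced; congr dg; apply/setP => w; apply/imsetP/idP => [[y _ ->]|wS].
  exact: valP.
by exists (exist _ w wS).
Qed.

End Transfer.

Lemma acyclicS (G : sgraph) (S C : {set G}) : C \subset S -> acyclic S -> acyclic C.
Proof. by move=> sCS aS B sBC; apply: aS; apply: subset_trans sBC sCS. Qed.

(** A vertex of a cycle with at least three vertices has two distinct
    neighbours on it. *)
Lemma acyclic_forest (K : sgraph) : acyclic [set: K] -> is_forest K.
Proof.
move=> aK c /andP[cyc_c uc]; rewrite ltnNge; apply/negP => c3.
have [||v] := aK [set x in c]; rewrite ?subsetT //.
  apply/set0Pn; case: c c3 {cyc_c uc} => // a c _; exists a; rewrite inE; exact: mem_head.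
rewrite inE => vc; apply/negP; rewrite -ltnNge.
have /rot_to[i s rot_c] := vc.
move: cyc_c uc c3; rewrite -(rot_cycle i) -(rot_uniq i) -(size_rot i) rot_c.
have -> : [set x in c] = [set x in v :: s].
  by apply/setP => x; rewrite !inE -(mem_rot i c) rot_c inE.
case: s {rot_c} => [|a [|b s]] //.
rewrite (cycle_path v) /= => /and4P[lv va ab _] us _.
apply: (@leq_trans (count (edge v) [:: a; last b s])).
  by rewrite /= va edgeC lv.
apply: leq_count_dg; last first.
  move=> y; rewrite !inE => /orP[]/eqP->; rewrite ?eqxx ?orbT //.
  by rewrite -in_cons mem_last !orbT.
rewrite /= andbT inE; apply: contraTneq us => ->.
by rewrite mem_last andbF.
Qed.

Section PathOfConnected.
Variable K : sgraph.
Implicit Types x y : K.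

Hypothesis dg_le2 : forall x, dg [set: K] x <= 2.
Hypothesis K_acyclic : acyclic [set: K].
Hypothesis K_connected : forall x y, connect (@edge K) x y.

Lemma dg_ge_seq x (s : seq K) : uniq s -> all (edge x) s -> size s <= dg [set: K] x.
Proof.
move=> us; rewrite all_count => /eqP <-; apply: leq_count_dg => // y _.
exact: in_setT.
Qed.

(** A longest path from a vertex of degree at most one meets every vertex, and
    has no chord, since its inner vertices already have two neighbours. *)
Lemma connected_is_path (x0 : K) : is_path_graph K.
Proof.
have [|v _ dv] := K_acyclic (subxx [set: K]).
  by apply/set0Pn; exists x0.
pose P n := `[< exists p, [/\ size p = n, path (@edge K) v p & uniq (v :: p)] >].
have exP : exists n, P n by exists 0; apply/asboolP; exists [::].
have boundP n : P n -> n <= #|K|.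
  move=> /asboolP[p [<- _ /= /andP[_ up]]].
  by rewrite -(card_uniqP up) max_card.
(* A longest path starting at a vertex [v] of degree at most one. *)
case: (ex_maxnP exP boundP) => n /asboolP[p [size_p path_p uniq_p]] max_n.
pose s := v :: p; pose s_ i := nth v s i.
have s_step i : i < n -> edge (s_ i) (s_ i.+1).
  by move=> lt_i; have /(pathP v)/(_ i) := path_p; rewrite size_p; apply.
have s_inj i j : i <= n -> j <= n -> (s_ i == s_ j) = (i == j).
  by move=> le_i le_j; apply: nth_uniq => //; rewrite /s /= ltnS size_p.
have s_mem i : i <= n -> s_ i \in s by move=> le_i; rewrite mem_nth //= ltnS size_p.
have nbr i y : i < n -> edge (s_ i) y ->
    y = s_ i.+1 \/ (exists2 j, i = j.+1 & y = s_ j).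
  move=> lt_i eiy; case: (eqVneq y (s_ i.+1)) => [|yS]; first by left.
  have e1 := s_step i lt_i; case: i lt_i eiy yS e1 => [|i] lt_i eiy yS e1.
    have := @dg_ge_seq (s_ 0) [:: y; s_ 1].
    rewrite /= inE yS eiy e1 => /(_ isT isT) /leq_trans/(_ dv); by [].
  right; exists i => //; apply/eqP; apply: contraT => yi.
  have := @dg_ge_seq (s_ i.+1) [:: y; s_ i.+2; s_ i].
  have e0 : edge (s_ i.+1) (s_ i) by rewrite edgeC; apply: s_step; apply: ltnW.
  rewrite /= !inE negb_or yS yi eiy e1 e0 s_inj ?(ltnW lt_i) //; last by lia.
  have -> : (i.+2 == i) = false by lia.
  by move=> /(_ isT isT) /leq_trans/(_ (dg_le2 _)).
have s_closed : closed (@edge K) (mem s).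
  apply: intro_closed => [|x y exy].
    by apply: sym_connect_sym => a b; apply: edge_sym.
  change (x \in s -> y \in s); move=> /(nthP v)[i]; rewrite /= ltnS size_p leq_eqVlt.
  case/orP => [/eqP->|lt_i] Ex; last first.
    move: exy; rewrite -Ex => /(nbr i y lt_i)[->|[j ij ->]]; apply: s_mem => //.
    by lia.
  apply: contraT => ys; have : P n.+1.
    apply/asboolP; exists (rcons p y); split; first by rewrite size_rcons size_p.
      rewrite rcons_path path_p /=; suff -> : last v p = x by [].
      by rewrite -Ex -size_p nth_last.
    by rewrite -rcons_cons rcons_uniq ys.
  by move/max_n; rewrite ltnn.
have all_s x : x \in s.
  by rewrite -(closed_connect s_closed (K_connected v x)) mem_head.
have idx_le x : index x s < n.+1 by rewrite -size_p -[(size p).+1]/(size s) index_mem.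
have s_idx x : s_ (index x s) = x by apply: nth_index.
exists n, (fun x => Ordinal (idx_le x)).
  exists (fun i : 'I_n.+1 => s_ i) => [x|i]; first exact: s_idx.
  by apply/val_inj; apply: (@index_uniq _ v i s) => //; rewrite /= size_p.
move=> x y.
change (((index x s).+1 == index y s) || ((index y s).+1 == index x s) = edge x y).
apply/orP/idP => [|exy].
  case=> /eqP E; rewrite -(s_idx x) -(s_idx y) -E; last rewrite edgeC.
    by apply: s_step; have := idx_le y; rewrite -E.
  by apply: s_step; have := idx_le x; rewrite -E.
have key a b : edge a b -> index a s < n ->
    (index a s).+1 == index b s \/ (index b s).+1 == index a s.
  rewrite -{1}(s_idx a) => eab la; have la' := la.
  case: (nbr _ _ la eab) => [Eb|[j Ej Eb]].
    by left; rewrite -s_inj ?s_idx -?Eb //; have := idx_le b.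
  right; have jn : j <= n by lia.
  have -> : index b s = j.
    by apply/eqP; rewrite -s_inj ?s_idx -?Eb //; have := idx_le b.
  by rewrite Ej.
have := idx_le x; rewrite ltnS leq_eqVlt => /orP[/eqP Ex|]; last first.
  by move/(key _ _ exy) => [->|->]; [left|right].
have lt_y : index y s < n.
  have := idx_le y; rewrite ltnS leq_eqVlt => /orP[/eqP Ey|//].
  have : x = y by rewrite -(s_idx x) -(s_idx y) Ex Ey.
  by move=> xy; move: exy; rewrite xy edgeN.
have eyx : edge y x by rewrite edgeC.
by case: (key _ _ eyx lt_y) => ->; [right|left].
Qed.

End PathOfConnected.

Lemma component_connected (K : sgraph) (x : K) (y z : induced (component x)) :
  connect (@edge (induced (component x))) y z.
Proof.
have csym : connect_sym (@edge (induced (component x))).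
  by apply: sym_connect_sym => a b; apply: edge_sym.
have xx : x \in component x by rewrite inE connect0.
pose x' : induced (component x) := exist _ x xx.
suff from_x : forall w : induced (component x), connect (@edge _) x' w.
  by apply: connect_trans (from_x z); rewrite csym.
case=> w wc; have := wc; rewrite inE => /connectP[p path_p last_p].
elim/last_ind: p w wc path_p last_p => [|p a IHp] w wc.
  by move=> _ /= wx; rewrite (_ : exist _ w wc = x') ?connect0 //; apply/val_inj.
rewrite rcons_path last_rcons => /andP[path_p ea] wa; subst a.
have lc : last x p \in component x by rewrite inE; apply/connectP; exists p.
apply: connect_trans (IHp _ lc path_p erefl) _.
exact: connect1.
Qed.

(** Each component is connected and acyclic with maximum degree two, hence a
    path. *)
Lemma admissible_linear_forest (G : sgraph) (F : {set G}) :
  admissible (fun=> 2) F -> linear_forest (induced F).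
Proof.
move=> [dF aF]; have aI := acyclic_induced aF.
split=> [|x]; first exact: acyclic_forest.
have xx : x \in component x by rewrite inE connect0.
apply: (@connected_is_path (induced (component x)) _ _ _ (exist _ x xx)).
- move=> y; rewrite dg_inducedT; apply: leq_trans (leq_dg _ (subsetT _)) _.
  by rewrite dg_inducedT; apply: dF; apply: valP.
- by apply: acyclic_induced; apply: acyclicS aI; apply: subsetT.
- exact: component_connected.
Qed.

(** A position on a path has at most two neighbouring positions. *)
Lemma linear_forest_dg (G : sgraph) (S : {set G}) x :
  linear_forest (induced S) -> x \in S -> dg S x <= 2.
Proof.
move=> [_ compS] xS; rewrite leqNgt; apply/negP => /card_gt2P.
case=> a [b [c [[aN bN cN] [ab bc ca]]]].
pose X : induced S := exist _ x xS.
have XX : X \in component X by rewrite inE connect0.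
pose X' : induced (component X) := exist _ X XX.
have [n [f [f' f'K _] f_edge]] := compS X.
have lift y : y \in nbs S x -> exists2 y' : induced (component X),
    val (val y') = y & edge X' y'.
  rewrite in_nbs => /andP[yS exy]; pose Y : induced S := exist _ y yS.
  have YX : Y \in component X by rewrite inE; apply: connect1.
  by exists (exist _ Y YX).
have [a' Ea ea] := lift a aN; have [b' Eb eb] := lift b bN;
  have [c' Ec ec] := lift c cN.
have inj u v : val (val u) != val (val v) -> (f u : nat) != f v.
  apply: contraNneq => fuv;
    have /(can_inj f'K) -> // : f u = f v by apply/val_inj.
have := inj a' b'; have := inj b' c'; have := inj c' a'.
rewrite Ea Eb Ec => /(_ ca) ca' /(_ bc) bc' /(_ ab) ab'.
move: ea eb ec; rewrite -!f_edge /= /path_edge.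
move: ab' bc' ca'; move: (f a' : nat) (f b' : nat) (f c' : nat) => i j k.
move: (f _ : nat) => l; lia.
Qed.

Lemma linear_forest_triangle (G : sgraph) (S : {set G}) x y z :
  linear_forest (induced S) -> x \in S -> y \in S -> z \in S ->
  edge x y -> edge y z -> edge z x -> False.
Proof.
move=> [forS _] xS yS zS exy eyz ezx.
pose c : seq (induced S) := [:: exist _ x xS; exist _ y yS; exist _ z zS].
have /forS // : ucycle (@edge (induced S)) c.
rewrite /ucycle /= /induced_edge /= exy eyz ezx /= !inE.
rewrite -!(inj_eq val_inj) /= (negPf (edge_neq exy)) (negPf (edge_neq eyz)).
by rewrite eq_sym (negPf (edge_neq ezx)).
Qed.

Lemma leq_alpha (C : sgraph -> Prop) (G : sgraph) (S : {set G}) :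
  C (induced S) -> #|S| <= alpha C G.
Proof.
by move=> CS; apply: (leq_bigmax_cond (F := fun S : {set G} => #|S|)); apply/asboolP.
Qed.

Lemma alpha_leq (C : sgraph -> Prop) (G : sgraph) n :
  (forall S : {set G}, C (induced S) -> #|S| <= n) -> alpha C G <= n.
Proof. by move=> leS; apply/bigmax_leqP => S /asboolP; apply: leS. Qed.

Local Open Scope ring_scope.

(** * Weights and reductions *)

Section Weights.
Variables (R : realFieldType) (G : sgraph) (cap : G -> nat) (g : G -> nat -> R).
Implicit Types (S C F Y Z : {set G}) (u v w x y z : G).

Definition wt S : R := \sum_(v in S) g v (dg S v).

Definition attained S : Prop :=
  exists F, [/\ F \subset S, admissible cap F & wt S <= #|F|%:R].

Definition minimal_failure S : Prop :=
  ~ attained S /\ forall S', S' \proper S -> attained S'.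

Lemma attained_minimal (P : {set G} -> Prop) :
  (forall S S', S' \subset S -> P S -> P S') ->
  (forall S, P S -> ~ minimal_failure S) ->
  forall S, P S -> attained S.
Proof.
move=> P_sub P_min S; move: {2}#|S|.+1 (ltnSn #|S|) => n.
elim: n S => // n IHn S lSn PS; apply: contrapT => nS.
apply: (P_min S PS); split=> // S' pS'; apply: IHn.
  by apply: leq_trans (proper_card pS') _.
exact: P_sub (proper_sub pS') PS.
Qed.

(** The only reduction used: keep [Y], discard the rest of [Z], and recurse on
    [S :\: Z], which [Y] does not touch. *)
Lemma minimal_keep S Y Z :
  minimal_failure S -> Y \subset Z -> Z \subset S -> Z != set0 ->
  admissible cap Y -> {in Y, forall y, nbs S y \subset Z} ->
  #|Y|%:R + wt (S :\: Z) < wt S.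
Proof.
move=> [nS minS] sYZ sZS Z0 aY nY; rewrite ltNge; apply/negP => le_wt.
have pS : S :\: Z \proper S.
  rewrite properE subsetDl; apply/subsetPn.
  by case/set0Pn: Z0 => x xZ; exists x; rewrite ?(subsetP sZS) // inE xZ.
case: (minS _ pS) => F [sF aF leF]; apply: nS; exists (F :|: Y); split.
- rewrite subUset (subset_trans sYZ sZS) andbT.
  exact: subset_trans sF (subsetDl _ _).
- apply: admissibleU => // u v /(subsetP sF); rewrite inE => /andP[uZ uS] vY.
  apply/negP => euv; case/negP: uZ; apply: (subsetP (nY v vY)).
  by rewrite in_nbs uS edgeC.
- apply: le_trans le_wt _; rewrite addrC (le_trans (lerD leF (lexx _))) //.
  rewrite -natrD ler_nat cardsU (_ : F :&: Y = set0) ?cards0 ?subn0 //.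
  apply/eqP; rewrite setI_eq0 disjoint_sym disjoints_subset.
  apply/subsetP => y /(subsetP sYZ) yZ; rewrite inE; apply/negP => /(subsetP sF).
  by rewrite inE yZ.
Qed.

Lemma wt_setD S Z : Z \subset S ->
  wt S = \sum_(v in Z) g v (dg S v) + wt (S :\: Z) -
    \sum_(v in S :\: Z) (g v (dg (S :\: Z) v) - g v (dg S v)).
Proof.
move=> sZS; rewrite {1}/wt (big_setID Z) /= (setIidPr sZS) -addrA; congr (_ + _).
by rewrite /wt -sumrB; apply: eq_bigr => v _; rewrite opprB addrC subrK.
Qed.

Section Antitone.
Hypothesis g_anti : forall v d, g v d.+1 <= g v d.

Lemma leq_antitone v d1 d2 : (d1 <= d2)%N -> g v d2 <= g v d1.
Proof.
move=> /subnK <-; elim: (_ - _)%N => // k IH.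
by apply: le_trans IH; rewrite addSn; apply: g_anti.
Qed.

Lemma minimal_keep_antitone S Y Z :
  minimal_failure S -> Y \subset Z -> Z \subset S -> Z != set0 ->
  admissible cap Y -> {in Y, forall y, nbs S y \subset Z} ->
  #|Y|%:R < \sum_(v in Z) g v (dg S v).
Proof.
move=> mS sYZ sZS Z0 aY nY; have := minimal_keep mS sYZ sZS Z0 aY nY.
rewrite (wt_setD sZS).
suff : 0 <= \sum_(v in S :\: Z) (g v (dg (S :\: Z) v) - g v (dg S v)) by lra.
by apply: sumr_ge0 => v _; rewrite subr_ge0 leq_antitone // leq_dg // subsetDl.
Qed.

End Antitone.

Lemma wt_delete S v : v \in S ->
  wt S = g v (dg S v) + wt (S :\ v) -
    \sum_(u in nbs S v) (g u (dg S u).-1 - g u (dg S u)).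
Proof.
move=> vS; rewrite (wt_setD (Z := [set v])) ?sub1set // big_set1; congr (_ - _).
rewrite [LHS](big_setID (nbs S v)) /= [X in _ + X]big1 ?addr0; last first.
  move=> u; rewrite !inE => /and3P[nuv uv uS].
  rewrite (dg_setD1 _ vS); move: nuv; rewrite uS edgeC /= => /negPf ->.
  by rewrite add0n subrr.
apply: eq_big => [u|u]; rewrite !inE.
  by case: eqVneq => [->|_]; rewrite ?edgeN ?andbF //=; case: (u \in S).
by case/andP => _ /andP[_ evu]; rewrite (dg_setD1 u vS) edgeC evu.
Qed.

(** The case [Y = set0] and [Z = [set v]] of the reduction. *)
Lemma minimal_delete S v : minimal_failure S -> v \in S ->
  \sum_(u in nbs S v) (g u (dg S u).-1 - g u (dg S u)) < g v (dg S v).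
Proof.
move=> mS vS; have : #|@set0 G|%:R + wt (S :\: [set v]) < wt S.
  apply: minimal_keep => //; rewrite ?sub0set ?sub1set //.
  - by apply/set0Pn; exists v; rewrite inE.
  - exact: admissible0.
  - by move=> y; rewrite inE.
rewrite cards0 add0r [wt S](wt_delete vS); lra.
Qed.

Section Linear.
Variables (N m : nat) (A : G -> nat).
Hypothesis N_gt0 : (0 < N)%N.
Variable S : {set G}.
Hypothesis g_lin : {in S, forall v d, (d <= dg S v)%N ->
  g v d = ((A v)%:R - m%:R * d%:R) / N%:R}.

Lemma sum_dg Z C : (\sum_(v in Z) dg C v = \sum_(v in C) dg Z v)%N.
Proof.
under eq_bigr do rewrite dgE.
rewrite exchange_big /=; apply: eq_bigr => v _; rewrite dgE.
by apply: eq_bigr => w _; rewrite edgeC.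
Qed.

(** For weights that are affine in the degree with a common slope, discarding
    [Z] changes the total by a quantity that only sees [Z] and its edges. *)
Lemma wt_linear Z : Z \subset S ->
  N%:R * wt S + (\sum_(v in Z) 2 * m * dg S v)%:R =
  N%:R * wt (S :\: Z) + (\sum_(v in Z) (A v + m * dg Z v))%:R.
Proof.
move=> sZS; have N0 : N%:R != 0 :> R by rewrite pnatr_eq0 -lt0n.
have wtN C : C \subset S ->
    N%:R * wt C = (\sum_(v in C) A v)%:R - m%:R * (\sum_(v in C) dg C v)%:R.
  move=> sC; rewrite mulr_sumr natr_sum (natr_sum _ _ _ (dg C)) mulr_sumr -sumrB.
  apply: eq_bigr => v vC.
  by rewrite g_lin ?(subsetP sC) ?leq_dg // mulrC divfK.
rewrite !wtN ?subsetDl //.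
have -> : (\sum_(v in S) A v = \sum_(v in Z) A v + \sum_(v in S :\: Z) A v)%N.
  by rewrite (big_setID Z) /= (setIidPr sZS).
have -> : (\sum_(v in S) dg S v = \sum_(v in Z) dg S v +
    (\sum_(v in S :\: Z) dg Z v + \sum_(v in S :\: Z) dg (S :\: Z) v))%N.
  rewrite (big_setID Z) /= (setIidPr sZS); congr (_ + _)%N.
  by rewrite -big_split; apply: eq_bigr => v _; rewrite /= (dgD _ sZS).
rewrite -big_distrr big_split /= -big_distrr /= (sum_dg (S :\: Z) Z).
have -> : (\sum_(v in Z) dg S v = \sum_(v in Z) dg Z v + \sum_(v in Z) dg (S :\: Z) v)%N.
  by rewrite -big_split; apply: eq_bigr => v _; rewrite /= (dgD _ sZS).
rewrite !(natrD, natrM); ring.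
Qed.

Lemma minimal_keep_linear (ys zs : seq G) :
  minimal_failure S -> uniq zs -> zs != [::] -> uniq ys ->
  {subset zs <= S} -> {subset ys <= zs} ->
  admissible cap [set y in ys] ->
  {in ys, forall y, nbs S y \subset [set x in zs]} ->
  (N * size ys + \sum_(a <- zs) 2 * m * dg S a <
   \sum_(a <- zs) (A a + m * count (edge a) zs))%N.
Proof.
move=> mS uzs zs0 uys szs sys ays nys.
have sZS : [set x in zs] \subset S by apply/subsetP => x; rewrite inE => /szs.
have := @minimal_keep S [set y in ys] [set x in zs] mS _ sZS _ ays _.
rewrite -(ltr_nat R) natrD natrM.
have -> : #|[set y in ys]| = size ys by rewrite cardsE; apply/card_uniqP.
have := wt_linear sZS.
have big_zs (F : G -> nat) : (\sum_(v in [set x in zs]) F v = \sum_(a <- zs) F a)%N.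
  by rewrite big_uniq //; apply: eq_bigl => a; rewrite inE.
rewrite !big_zs; under [in RHS]eq_bigr do rewrite dg_seq //.
set a := (\sum_(_ <- _) 2 * m * _)%N; set b := (\sum_(_ <- _) (_ + _))%N.
move=> eqN ltw; have N0 : 0 < N%:R :> R by rewrite ltr0n.
have : N%:R * ((size ys)%:R + wt (S :\: [set x in zs])) < N%:R * wt S.
  rewrite ltr_pM2l //; apply: ltw.
  - by apply/subsetP => y; rewrite !inE => /sys.
  - by apply/set0Pn; case: (zs) zs0 => // x s _; exists x; rewrite !inE eqxx.
  - by move=> y; rewrite inE; apply: nys.
rewrite mulrDr; lra.
Qed.

End Linear.

End Weights.

(** * Hyperbolic weights with an affine start *)

Section Chain.
Variable R : realFieldType.

(** The affine branch of slope [- m / N] and the hyperbola [c / d.+1] meet at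
    degree [D.-1]; this condition determines [c]. *)
Definition chain (N m A D d : nat) : R :=
  if (d < D)%N then (A%:R - m%:R * d%:R) / N%:R
  else D%:R * (A%:R - m%:R * D.-1%:R) / (N%:R * d.+1%:R).

Variables (N m A D : nat).
Hypotheses (N_gt0 : (0 < N)%N) (D_gt0 : (0 < D)%N).

Let N0 : N%:R != 0 :> R. Proof. by rewrite pnatr_eq0 -lt0n. Qed.

Lemma chain_tail d : (D.-1 <= d)%N ->
  chain N m A D d = D%:R * (A%:R - m%:R * D.-1%:R) / (N%:R * d.+1%:R).
Proof.
rewrite /chain; case: ifP => // dD dD'.
have -> : d = D.-1 by lia.
rewrite prednK //.
have D0 : D%:R != 0 :> R by rewrite pnatr_eq0 -lt0n.
field; rewrite ?N0 ?D0 //.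
Qed.

Lemma chain_drop_affine d : (0 < d < D)%N ->
  chain N m A D d.-1 - chain N m A D d = m%:R / N%:R.
Proof.
case: d => // d /andP[_ dD]; rewrite /chain dD (ltnW dD) /= -natr1; field.
by rewrite N0.
Qed.

Lemma chain_drop_tail d : (D <= d)%N ->
  chain N m A D d.-1 - chain N m A D d = chain N m A D d / d%:R.
Proof.
case: d => [|d] dD; first lia.
rewrite !chain_tail /=; [|lia..].
rewrite -[d.+2%:R]natr1 -[d.+1%:R]natr1; have d_ge0 : 0 <= d%:R :> R by [].
by field; rewrite N0 !lt0r_neq0 //; lra.
Qed.

(** The assumption on [A] says that deleting a vertex of degree [D] costs at
    most what its [D] neighbours gain in the affine regime. *)
Lemma chain_tail_le d : (A <= 2 * m * D)%N -> (D <= d)%N ->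
  chain N m A D d / d%:R <= m%:R / N%:R.
Proof.
move=> leA dD; rewrite chain_tail; last lia.
have N1 : 0 < N%:R :> R by rewrite ltr0n.
have d0 : 0 < d%:R :> R by rewrite ltr0n; lia.
have d1 : 0 < d.+1%:R :> R by rewrite ltr0n.
rewrite ler_pdivrMr // ler_pdivrMr; last by rewrite mulr_gt0.
have -> : m%:R / N%:R * d%:R * (N%:R * d.+1%:R) = (m * d * d.+1)%:R :> R.
  by rewrite !natrM; field; rewrite N0.
have -> : D%:R * (A%:R - m%:R * D.-1%:R) = (D * A)%:R - (D * (m * D.-1))%:R :> R.
  by rewrite mulrBr !natrM.
by rewrite lerBlDr -natrD ler_nat; nia.
Qed.

Lemma chain_anti d : (m * D.-1 <= A)%N -> chain N m A D d.+1 <= chain N m A D d.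
Proof.
move=> leA; rewrite -subr_ge0; case: (ltnP d.+1 D) => dD.
  by rewrite (@chain_drop_affine d.+1) ?dD // divr_ge0.
rewrite (@chain_drop_tail d.+1) // chain_tail; last lia.
by rewrite !(divr_ge0, mulr_ge0) // subr_ge0 -natrM ler_nat.
Qed.

End Chain.

Section Light.
Variables (R : realFieldType) (G : sgraph) (cap : G -> nat) (N m : nat).
Variables (A D : G -> nat).
Hypotheses (N_gt0 : (0 < N)%N) (D_gt0 : forall v, (0 < D v)%N).
Hypothesis leA : forall v, (A v <= 2 * m * D v)%N.

Let g v d : R := chain R N m (A v) (D v) d.

(** Greedy deletion.  In the tail of a chain, deleting [v] costs [g v d], while
    [d] neighbours each gain at least the quotient [g v d / d], provided [v]
    minimises this quotient among the vertices of large degree. *)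
Lemma minimal_light S : minimal_failure cap g S ->
  {in S, forall v, (dg S v < D v)%N}.
Proof.
move=> mS v0 v0S; rewrite ltnNge; apply/negP => heavy0.
pose P v := (v \in S) && (D v <= dg S v)%N.
have P0 : P v0 by rewrite /P v0S.
case: (arg_minP (fun v => g v (dg S v) / (dg S v)%:R) P0).
move=> v /andP[vS heavy] v_min.
have := minimal_delete mS vS; apply/negP; rewrite -leNgt.
have dv0 : (dg S v)%:R != 0 :> R by rewrite pnatr_eq0 -lt0n (leq_trans _ heavy).
have -> : g v (dg S v) = \sum_(u in nbs S v) (g v (dg S v) / (dg S v)%:R).
  by rewrite sumr_const -/(dg S v) -[RHS]mulr_natr divfK.
apply: ler_sum => u; rewrite in_nbs => /andP[uS evu].
have du : (0 < dg S u)%N by rewrite (dg_setD1 _ vS) edgeC evu.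
case: (leqP (D u) (dg S u)) => [heavy_u|light_u].
  by rewrite /g chain_drop_tail //; apply: v_min; rewrite /P uS.
by rewrite /g [X in _ <= X]chain_drop_affine ?du //; apply: chain_tail_le.
Qed.

End Light.

(** * Graphs without leaves *)

Section Plain.
Variables (R : realFieldType) (G : sgraph) (cap : G -> nat).
Implicit Types (S C : {set G}).

(** Once all degrees are at most two, either the whole set is acyclic, or a
    minimal set of minimum degree two is a cycle without further neighbours; it
    has at least three vertices, and all but one of them are kept. *)
Lemma attained_plain S : {in S, forall v, (2 <= cap v)%N} ->
  attained cap (fun _ => chain R 6 1 6 3) S.
Proof.
move: S; apply: attained_minimal => [S S' /subsetP sS' capS v /sS'|S capS mS].
  exact: capS.
have light : {in S, forall v, (dg S v <= 2)%N}.
  exact: (@minimal_light _ _ _ _ _ (fun=> 6%N) (fun=> 3%N) _ _ _ _ mS).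
pose cyc C := [&& C \subset S, C != set0 & [forall v in C, (1 < dg C v)%N]].
have [[C0 cycC0]|acS] := pselect (exists C, cyc C); last first.
  case: mS => nS _; apply: nS; exists S; split=> //.
    split=> [v vS|C sC C0]; first exact: leq_trans (light v vS) (capS v vS).
    apply: contrapT => nC; apply: acS; exists C; rewrite /cyc sC C0 /=.
    apply/forall_inP => v vC; rewrite ltnNge; apply/negP => dv.
    by apply: nC; exists v.
  rewrite -sum1_card natr_sum; apply: ler_sum => v vS.
  by rewrite /chain ltnS light // mul1r; have := ler0n R (dg S v); lra.
case: (arg_minnP (fun C : {set G} => #|C|) cycC0) => C /and3P[sC C_n0 cC] C_min.
case/set0Pn: (C_n0) => v vC.
have closedC w : w \in C -> nbs S w \subset C.
  move=> wC; have : nbs C w == nbs S w.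
    rewrite eqEcard sub_nbs //= -/(dg S w) -/(dg C w).
    by apply: leq_trans (forall_inP cC w wC); apply: light; apply: (subsetP sC).
  by move/eqP<-; apply/subsetP => u; rewrite in_nbs => /andP[].
have := @minimal_keep_antitone R G cap (fun _ => chain R 6 1 6 3) _ S (C :\ v) C mS
   (subsetDl _ _) sC C_n0 _ _.
have -> : \sum_(w in C) chain R 6 1 6 3 (dg S w) = #|C|%:R * (2 / 3).
  rewrite (eq_bigr (fun=> 2 / 3)) ?sumr_const ?mulr_natl // => w wC.
  have dw : dg S w = 2.
    apply/eqP; rewrite eqn_leq light ?(subsetP sC) //=.
    exact: leq_trans (forall_inP cC w wC) (leq_dg _ sC).
  by rewrite dw /chain /=; field.
have cardC : (2 < #|C|)%N.
  rewrite (cardsD1 v) vC ltnS; apply: leq_trans (forall_inP cC v vC) _.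
  apply: subset_leq_card; apply/subsetP => w; rewrite in_nbs !inE => /andP[-> evw].
  by rewrite eq_sym edge_neq.
have cardR : 3 <= #|C|%:R :> R by rewrite (ler_nat R 3).
have -> : #|C :\ v|%:R = #|C|%:R - 1 :> R.
  by rewrite [in RHS](cardsD1 v) vC -natr1 addrK.
move=> lt; suff : #|C|%:R - 1 < #|C|%:R * (2 / 3) :> R by lra.
apply: lt.
- by move=> _ d; apply: chain_anti.
- split=> [w|C' sC' C'0].
    rewrite !inE => /andP[_ wC]; apply: leq_trans (capS w (subsetP sC w wC)).
    apply: leq_trans (light w (subsetP sC w wC)); apply: leq_dg.
    exact: subset_trans (subsetDl _ _) sC.
  apply: contrapT => nC'.
  have sC'C : C' \subset C by apply: subset_trans sC' (subsetDl _ _).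
  have /C_min : cyc C'.
    rewrite /cyc C'0 (subset_trans sC'C sC) /=.
    apply/forall_inP => w wC'; rewrite ltnNge; apply/negP => dw.
    by apply: nC'; exists w.
  apply/negP; rewrite -ltnNge; apply: proper_card; rewrite properE sC'C.
  by apply/subsetPn; exists v => //; apply/negP => /(subsetP sC'); rewrite !inE eqxx.
- by move=> w; rewrite inE => /andP[_ /closedC].
Qed.

End Plain.

(** * Local configurations *)

Section Neighbours.
Variable G : sgraph.
Implicit Types (S U X : {set G}) (v w p q r : G).

Lemma nbs0 S v : dg S v = 0%N -> nbs S v = set0.
Proof. by move/eqP; rewrite cards_eq0 => /eqP. Qed.

Lemma nbs1 S v p : dg S v = 1%N -> p \in nbs S v -> nbs S v = [set p].
Proof. by move/eqP/cards1P => [x ->]; rewrite inE => /eqP->. Qed.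

Lemma nbs1_ex S v : dg S v = 1%N -> exists p, nbs S v = [set p].
Proof. by move/eqP/cards1P. Qed.

Lemma nbs2 S v p : dg S v = 2 -> p \in nbs S v ->
  exists2 q, q != p & nbs S v = [set p; q].
Proof.
move=> d2 pv; have := cardsD1 p (nbs S v); rewrite pv -/(dg S v) d2.
move/eqP; rewrite eqSS eq_sym => /cards1P[q Eq]; exists q.
  have : q \in nbs S v :\ p by rewrite Eq inE.
  by rewrite !inE => /andP[].
by rewrite -(setD1K pv) Eq.
Qed.

Lemma nbs2_ex S v : dg S v = 2 -> exists p q, p != q /\ nbs S v = [set p; q].
Proof. by move/eqP/cards2P => [p [q [pq E]]]; exists p, q. Qed.

Lemma nbs3 S v p q : dg S v = 3 -> p \in nbs S v -> q \in nbs S v -> p != q ->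
  exists r, [/\ r != p, r != q & nbs S v = [set p; q; r]].
Proof.
move=> d3 pv qv pq; have := cardsD1 p (nbs S v); rewrite pv -/(dg S v) d3.
have qv' : q \in nbs S v :\ p by rewrite in_setD1 eq_sym pq.
rewrite (cardsD1 q) qv' => /eqP; rewrite !eqSS eq_sym => /cards1P[r Er]; exists r.
have : r \in (nbs S v :\ p) :\ q by rewrite Er inE.
rewrite !in_setD1 => /and3P[-> -> _]; split=> //.
by rewrite -(setD1K pv) -(setD1K qv') Er setUA.
Qed.

Lemma edge_nbs U X v w : w \in U -> nbs U v = X -> edge v w = (w \in X).
Proof. by move=> wS <-; rewrite in_nbs wS. Qed.

Lemma mem_nbs_set U X v w : nbs U v = X -> w \in X -> (w \in U) * edge v w * edge w v.
Proof.
move=> <-; rewrite in_nbs => /andP[wS evw]; split; first by split.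
by rewrite edgeC.
Qed.

Section AdmissiblePaths.
Variable cap : G -> nat.

Let adm (s : seq G) := admissible cap [set x in s].

Lemma adm1 a : adm [:: a].
Proof.
rewrite /adm (_ : [set x in [:: a]] = [set a]); first exact: admissible1.
by apply/setP => x; rewrite !inE.
Qed.

Lemma adm_cons a b s : adm (b :: s) -> a \notin b :: s -> uniq (b :: s) ->
  all (fun w => ~~ edge a w) s -> (count (edge b) s < cap b)%N -> (0 < cap a)%N ->
  adm [:: a, b & s].
Proof.
move=> ads nas us /allP eas cb ca.
rewrite /adm (_ : [set x in _] = a |: [set x in b :: s]); last first.
  by apply/setP => x; rewrite !inE.
apply: (@admissible_extend _ _ _ b) => //; rewrite ?inE ?eqxx //.
  move=> w; rewrite !inE => /orP[/eqP->|/eas /negPf //]; by rewrite eqxx.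
by rewrite dg_seq //= edgeN.
Qed.

Lemma adm2 a b : a != b -> (0 < cap a)%N -> (0 < cap b)%N -> adm [:: a; b].
Proof. by move=> ab ca cb; apply: adm_cons => //; rewrite ?inE //; apply: adm1. Qed.

Lemma adm3 a b c : a != b -> a != c -> b != c -> ~~ edge a c ->
  (0 < cap a)%N -> (1 < cap b)%N -> (0 < cap c)%N -> adm [:: a; b; c].
Proof.
move=> ab ac bc eac ca cb cc; apply: adm_cons; rewrite /= ?andbT ?inE ?negb_or ?ab //.
  by apply: adm2 => //; apply: ltnW.
by case: edge => /=; rewrite addn0 // ltnW.
Qed.

Lemma adm4 a b c d : uniq [:: a; b; c; d] ->
  ~~ edge a c -> ~~ edge a d -> ~~ edge b d ->
  (0 < cap a)%N -> (1 < cap b)%N -> (1 < cap c)%N -> (0 < cap d)%N ->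
  adm [:: a; b; c; d].
Proof.
move=> us eac ead ebd ca cb cc cd.
have := us; rewrite cons_uniq => /andP[na ubcd].
apply: adm_cons; rewrite //= ?eac ?ead ?(negPf ebd) //.
  move: ubcd; rewrite /= !inE !negb_or => /and3P[/andP[bc bd] cd' _].
  by apply: adm3 => //; apply: ltnW.
by case: edge => /=; lia.
Qed.

End AdmissiblePaths.

End Neighbours.

Ltac solve_uniq := rewrite /= ?inE ?negb_or; repeat (apply/andP; split => //);
  first [done | by rewrite eq_sym].
Ltac cover_with H := rewrite H; apply/subsetP => ?; rewrite !inE;
  repeat match goal with |- context [?x == ?y] => case: (x == y) end => //.
Ltac solve_cover := rewrite /= ?andbT; repeat (apply/andP; split);
  match goal with |- context [nbs ?S ?v] =>
    match goal with H : nbs S v = _ |- _ => cover_with H end end.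
Ltac solve_mem := rewrite /=; repeat (apply/andP; split => //).
Ltac known_edges := repeat match goal with
  | H : is_true (edge ?a ?b) |- context [edge ?a ?b] => rewrite H
  | H : is_true (~~ edge ?a ?b) |- context [edge ?a ?b] => rewrite (negPf H)
  end.
(* The final counts only involve degrees, weights and unknown adjacencies. *)
Ltac forget := repeat match goal with
  | H : is_true (_ != _) |- _ => clear H
  | H : is_true (_ \in _) |- _ => clear H
  | H : is_true (edge _ _) |- _ => clear H
  | H : is_true (~~ edge _ _) |- _ => clear H
  end.
Ltac count_edges := rewrite /= !big_cons !big_nil /= ?edgeN; known_edges; forget; lia.


(** The kind of a vertex that survives the removal of all leaves: the number of
    leaves it carried or, for [Slim], that its original degree is two. *)
Inductive kind := Free | OneLeaf | TwoLeaves | Slim.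

Definition kcap k : nat :=
  match k with Free | Slim => 2 | OneLeaf => 1 | TwoLeaves => 0 end.

(** Weights for [1 / 12 <= eps], and for the second stage otherwise, over the
    denominator [36] and with slope [- 4 / 36].  The hyperbolas that they join
    are [2 / d.+1], [4 / 3 / d.+1] and [1 / 2 / d.+1] for the first three kinds;
    a vertex of kind [Slim] has weight [2 / 3] at its original degree two. *)
Definition A_large k : nat :=
  match k with Free => 30 | OneLeaf => 24 | TwoLeaves => 13 | Slim => 32 end.

Definition D_large k : nat :=
  match k with Free => 4 | OneLeaf => 3 | TwoLeaves => 2 | Slim => 4 end.

(** Weights for [eps <= 1 / 12], over the denominator [90] and with slope
    [- 5 / 90].  Kind [TwoLeaves] now follows [2 / 3 / d.+1], which exceeds its
    weight for [1 / 12 <= eps]; this is why a flatter slope is needed at small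
    degrees. *)
Definition A_small k : nat :=
  match k with Free => 55 | OneLeaf => 44 | TwoLeaves => 30 | Slim => 70 end.

Definition D_small k : nat :=
  match k with Free => 6 | OneLeaf => 5 | TwoLeaves => 3 | Slim => 7 end.

Notation large R k := (chain R 36 4 (A_large k) (D_large k)).
Notation small R k := (chain R 90 5 (A_small k) (D_small k)).

Definition is_one k := if k is OneLeaf then true else false.
Definition is_two k := if k is TwoLeaves then true else false.
Definition is_slim k := if k is Slim then true else false.

Section Labelled.
Variables (R : realFieldType) (G : sgraph) (lab : G -> kind).
Implicit Types (S : {set G}) (v w p q s x y z : G).

Let cap v := kcap (lab v).

Section Irreducible.
Variables (N m : nat) (A D : kind -> nat).
Hypotheses (N_gt0 : (0 < N)%N) (D_gt0 : forall k, (0 < D k)%N).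
Hypothesis leA : forall k, (A k <= 2 * m * D k)%N.
Variable S : {set G}.
Hypothesis mS : minimal_failure cap (fun v => chain R N m (A (lab v)) (D (lab v))) S.

Lemma kind_light v : v \in S -> (dg S v < D (lab v))%N.
Proof.
exact: (@minimal_light R G cap N m (A \o lab) (D \o lab) N_gt0
  (fun v => D_gt0 (lab v)) (fun v => leA (lab v)) S mS).
Qed.

(** If keeping [ys] and discarding [rest] is a legitimate reduction, then it
    must fail for numerical reasons.  By [wt_linear], up to the factor [N] the
    weight lost is the sum of [A - 2 * m * dg] over all these vertices plus [m]
    times their degree sum among themselves. *)
Lemma irreducible (ys rest : seq G) :
  ys != [::] -> uniq (ys ++ rest) -> all (mem S) (ys ++ rest) ->
  admissible cap [set y in ys] ->
  all (fun y => nbs S y \subset [set x in ys ++ rest]) ys ->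
  (N * size ys + \sum_(a <- ys ++ rest) 2 * m * dg S a <
   \sum_(a <- ys ++ rest) (A (lab a) + m * count (edge a) (ys ++ rest)))%N.
Proof.
move=> ys0 us /allP sS ays /allP nys.
apply: (minimal_keep_linear (R := R) N_gt0 _ mS) => //.
- move=> v vS d dv; rewrite /chain ifT //.
  exact: leq_ltn_trans dv (kind_light vS).
- by case: (ys) ys0.
- by move: us; rewrite cat_uniq => /andP[].
- by move=> x xy; rewrite mem_cat xy.
Qed.

End Irreducible.

End Labelled.

(** * Removing vertices with one leaf *)

Section RemoveOnes.
Variables (R : realFieldType) (G : sgraph) (lab : G -> kind).
Implicit Types (v w p q s x y z : G).

Let cap v := kcap (lab v).

Variable S : {set G}.
Hypothesis mS : minimal_failure cap (fun v => large R (lab v)) S.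
Hypothesis two_slim :
  {in S &, forall v w, is_two (lab v) -> is_slim (lab w) -> ~~ edge v w}.
Hypothesis slim_dg : {in S, forall v, is_slim (lab v) -> (dg S v <= 2)%N}.

Let irr (ys rest : seq G) : ys != [::] -> uniq (ys ++ rest) ->
  all (mem S) (ys ++ rest) -> admissible cap [set y in ys] ->
  all (fun y => nbs S y \subset [set x in ys ++ rest]) ys ->
  (36 * size ys + \sum_(a <- ys ++ rest) 2 * 4 * dg S a <
   \sum_(a <- ys ++ rest) (A_large (lab a) + 4 * count (edge a) (ys ++ rest)))%N.
Proof.
by apply: (irreducible (R := R) (D := D_large)) => //; case.
Qed.

Let light v : v \in S -> (dg S v < D_large (lab v))%N.
Proof. by apply: (kind_light (R := R) (N := 36) (m := 4) (A := A_large)) => //; case. Qed.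

(** A vertex [z] with two leaves has degree at most one.  It is kept, and its
    neighbour [p], if any, is discarded; this suffices because [p] is not
    [Slim]. *)
Lemma no_twos_large : {in S, forall z, ~~ is_two (lab z)}.
Proof.
move=> z zS; apply/negP => z2;
  have labz : lab z = TwoLeaves by case: (lab z) z2.
have az : A_large (lab z) = 13%N by rewrite labz.
have := light zS; rewrite labz /= !ltnS leq_eqVlt ltnS leqn0 => /orP[]/eqP dz.
  have [p Ez] := nbs1_ex dz; have [[pS ezp] epz] := mem_nbs_set Ez (set11 p).
  have zp := edge_neq ezp.
  have dp : (0 < dg S p)%N by rewrite (dg_setD1 _ zS) epz.
  have ap : (A_large (lab p) <= 30)%N.
    by case labp: (lab p) => //;
      have := two_slim zS pS z2; rewrite labp ezp => /(_ isT).
  have := @irr [:: z] [:: p] isT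
    ltac:(solve_uniq) ltac:(solve_mem) (adm1 _ _) ltac:(solve_cover).
  by count_edges.
have Ez := nbs0 dz.
have := @irr [:: z] [::] isT
  ltac:(solve_uniq) ltac:(solve_mem) (adm1 _ _) ltac:(solve_cover).
by count_edges.
Qed.

(* Once kind [TwoLeaves] is excluded, only [Free] allows degree three. *)
Let A_range v : v \in S ->
  (A_large (lab v) <= 32)%N &&
    ((dg S v <= 2) || (A_large (lab v) == 30%N) && (dg S v <= 3))%N.
Proof.
move=> vS; have := no_twos_large vS; have := light vS; have := slim_dg vS.
case: (lab v) => //=; lia.
Qed.

Let cap1 v : v \in S -> (0 < cap v)%N.
Proof. by move=> vS; have := no_twos_large vS; rewrite /cap; case: (lab v). Qed.

Let cap2 v : v \in S -> ~~ is_one (lab v) -> (1 < cap v)%N.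
Proof. by move=> vS; have := no_twos_large vS; rewrite /cap; case: (lab v). Qed.

Let Aone v : is_one (lab v) -> A_large (lab v) = 24%N. Proof. by case: (lab v). Qed.

Let dg_pos v w : w \in S -> edge v w -> (0 < dg S v)%N.
Proof. by move=> wS evw; rewrite (dg_setD1 _ wS) evw. Qed.

(** A vertex [z] with one leaf and a single neighbour [p] is kept, together
    with [p] unless [p] has degree three. *)
Lemma one_dg z : z \in S -> is_one (lab z) -> dg S z = 2.
Proof.
move=> zS z1; have az := Aone z1; have := light zS.
have -> : D_large (lab z) = 3%N by case: (lab z) z1.
case dz: (dg S z) => [|[|[|d]]] // _.
  have Ez := nbs0 dz.
  have := @irr [:: z] [::] isT
    ltac:(solve_uniq) ltac:(solve_mem) (adm1 _ _) ltac:(solve_cover).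
  by count_edges.
have [p Ez] := nbs1_ex dz; have [[pS ezp] epz] := mem_nbs_set Ez (set11 p).
have zp := edge_neq ezp; have dp := dg_pos zS epz; have fp := A_range pS.
have zNp : z \in nbs S p by rewrite in_nbs zS.
case Dp: (dg S p) dp => [|[|[|[|d]]]] // _; last by forget; lia.
- have Ep := nbs1 Dp zNp.
  have := @irr [:: z; p] [::] isT ltac:(solve_uniq) ltac:(solve_mem)
    (adm2 zp (cap1 zS) (cap1 pS)) ltac:(solve_cover).
  by count_edges.
- have [s sz Ep] := nbs2 Dp zNp;
    have [[sS eps] esp] := mem_nbs_set Ep (set22 z s).
  have ps := edge_neq eps; have ds := dg_pos pS esp; have fs := A_range sS.
  have ezs : ~~ edge z s by rewrite (edge_nbs sS Ez) inE eq_sym.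
  have esz : ~~ edge s z by rewrite edgeC.
  have := @irr [:: z; p] [:: s] isT ltac:(solve_uniq) ltac:(solve_mem)
    (adm2 zp (cap1 zS) (cap1 pS)) ltac:(solve_cover).
  by count_edges.
- have := @irr [:: z] [:: p] isT
  ltac:(solve_uniq) ltac:(solve_mem) (adm1 _ _) ltac:(solve_cover).
  by count_edges.
Qed.

(** Otherwise [z] and its end neighbour [p] are kept, and the other neighbour
    of [z] is discarded. *)
Lemma one_nbs_dg z p : z \in S -> is_one (lab z) -> p \in S -> edge z p ->
  (2 <= dg S p)%N.
Proof.
move=> zS z1 pS ezp; have az := Aone z1; have dz := one_dg zS z1.
have pNz : p \in nbs S z by rewrite in_nbs pS.
have [q qp Ez] := nbs2 dz pNz;
  have [[qS ezq] eqz] := mem_nbs_set Ez (set22 p q).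
have epz : edge p z by rewrite edgeC.
have dp := dg_pos zS epz; rewrite ltn_neqAle dp andbT; apply/negP => /eqP Dp.
have zNp : z \in nbs S p by rewrite in_nbs zS.
have Ep := nbs1 (esym Dp) zNp.
have zp := edge_neq ezp; have zq := edge_neq ezq; have dq := dg_pos zS eqz.
have fp := A_range pS; have fq := A_range qS.
have epq : ~~ edge p q by rewrite (edge_nbs qS Ep) inE eq_sym.
have eqp : ~~ edge q p by rewrite edgeC.
have := @irr [:: z; p] [:: q] isT ltac:(solve_uniq) ltac:(solve_mem)
    (adm2 zp (cap1 zS) (cap1 pS)) ltac:(solve_cover).
by count_edges.
Qed.

(** If [z] and [p] both carry a leaf, both are kept, at the expense of their
    other neighbours [q] and [s].  The exception is a 4-cycle [z p s q] whose
    vertices [q] and [s] have no further neighbour; there [z] is discarded. *)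
Lemma one_nbs_notone z p : z \in S -> is_one (lab z) -> p \in S -> edge z p ->
  ~~ is_one (lab p).
Proof.
move=> zS z1 pS ezp; apply/negP => p1.
have [az ap] := (Aone z1, Aone p1);
  have [dz dp] := (one_dg zS z1, one_dg pS p1).
have pNz : p \in nbs S z by rewrite in_nbs pS.
have zNp : z \in nbs S p by rewrite in_nbs zS edgeC.
have [q qp Ez] := nbs2 dz pNz;
  have [[qS ezq] eqz] := mem_nbs_set Ez (set22 p q).
have [s sz Ep] := nbs2 dp zNp;
  have [[sS eps] esp] := mem_nbs_set Ep (set22 z s).
have zp := edge_neq ezp; have zq := edge_neq ezq; have ps := edge_neq eps.
have epz : edge p z by rewrite edgeC.
have dq := one_nbs_dg zS z1 qS ezq; have ds := one_nbs_dg pS p1 sS eps.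
have fq := A_range qS; have fs := A_range sS.
have [sq|sq] := eqVneq s q.
  rewrite sq in eps esp Ep.
  have := @irr [:: z; p] [:: q] isT ltac:(solve_uniq) ltac:(solve_mem)
    (adm2 zp (cap1 zS) (cap1 pS)) ltac:(solve_cover).
  by count_edges.
have ezs : ~~ edge z s by rewrite (edge_nbs sS Ez) !inE negb_or sq eq_sym ps.
have esz : ~~ edge s z by rewrite edgeC.
have epq : ~~ edge p q by rewrite (edge_nbs qS Ep) !inE negb_or eq_sym zq eq_sym sq.
have eqp : ~~ edge q p by rewrite edgeC.
have eqs : edge q s = edge s q by rewrite edgeC.
have := @irr [:: z; p] [:: q; s] isT ltac:(solve_uniq) ltac:(solve_mem)
    (adm2 zp (cap1 zS) (cap1 pS)) ltac:(solve_cover).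
rewrite /= !big_cons !big_nil /= !edgeN; known_edges; rewrite eqs.
case Esq: (edge s q) eqs => eqs; last by forget; lia.
move=> I1; have dq2 : dg S q = 2%N by forget; lia.
have ds2 : dg S s = 2%N by forget; lia.
have s1 : ~~ is_one (lab s) by apply/negP => /Aone as1; forget; lia.
have zNq : z \in nbs S q by rewrite in_nbs zS.
have pNs : p \in nbs S s by rewrite in_nbs pS.
have [s' sz' Eq] := nbs2 dq2 zNq.
have ss' : s' = s.
  have : s \in nbs S q by rewrite in_nbs sS eqs.
  by rewrite Eq !inE (negPf sz) => /eqP.
have [q' qp' Es] := nbs2 ds2 pNs.
have qq' : q' = q.
  have : q \in nbs S s by rewrite in_nbs qS.
  by rewrite Es !inE (negPf qp) => /eqP.
subst s' q'.
have pq : p != q by rewrite eq_sym.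
have := @irr [:: p; s; q] [:: z] isT ltac:(solve_uniq) ltac:(solve_mem)
  (adm3 ps pq sq epq (cap1 pS) (cap2 sS s1) (cap1 qS)) ltac:(solve_cover).
by count_edges.
Qed.

(** If a neighbour [p] of [z] has degree two, then the path [z p s ...] is
    followed until it can be cut off.  It may close up to a 4-cycle or 5-cycle
    through the other neighbour [q] of [z]; then a path through all but one of
    its vertices is kept. *)
Lemma one_nbs_dg3 z p : z \in S -> is_one (lab z) -> p \in S -> edge z p ->
  dg S p = 3.
Proof.
move=> zS z1 pS ezp; have az := Aone z1; have dz := one_dg zS z1.
have dp2 := one_nbs_dg zS z1 pS ezp; have fp := A_range pS.
have pn1 := one_nbs_notone zS z1 pS ezp.
case Dp: (dg S p) dp2 => [|[|[|[|d]]]] // _; last by forget; lia.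
exfalso.
have pNz : p \in nbs S z by rewrite in_nbs pS.
have [q qp Ez] := nbs2 dz pNz;
  have [[qS ezq] eqz] := mem_nbs_set Ez (set22 p q).
have epz : edge p z by rewrite edgeC.
have zNp : z \in nbs S p by rewrite in_nbs zS.
have zNq : z \in nbs S q by rewrite in_nbs zS.
have [s sz Ep] := nbs2 Dp zNp;
  have [[sS eps] esp] := mem_nbs_set Ep (set22 z s).
have pNs : p \in nbs S s by rewrite in_nbs pS.
have zp := edge_neq ezp; have zq := edge_neq ezq; have ps := edge_neq eps.
have zs : z != s by rewrite eq_sym.
have pq : p != q by rewrite eq_sym.
have dq := one_nbs_dg zS z1 qS ezq; have ds := dg_pos pS esp.
have fq := A_range qS; have fs := A_range sS.
have [sq|sq] := eqVneq s q.
  rewrite sq in eps esp Ep.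
  have := @irr [:: z; p] [:: q] isT ltac:(solve_uniq) ltac:(solve_mem)
    (adm2 zp (cap1 zS) (cap1 pS)) ltac:(solve_cover).
  by count_edges.
have ezs : ~~ edge z s by rewrite (edge_nbs sS Ez) !inE negb_or sq eq_sym ps.
have esz : ~~ edge s z by rewrite edgeC.
have epq : ~~ edge p q by rewrite (edge_nbs qS Ep) !inE negb_or eq_sym zq eq_sym sq.
have eqp : ~~ edge q p by rewrite edgeC.
have eqs : edge q s = edge s q by rewrite edgeC.
case Ds: (dg S s) ds => [|[|[|[|d]]]] // _; last by forget; lia.
- have Es := nbs1 Ds pNs.
  have := @irr [:: z; p; s] [:: q] isT ltac:(solve_uniq) ltac:(solve_mem)
    (adm3 zp zs ps ezs (cap1 zS) (cap2 pS pn1) (cap1 sS)) ltac:(solve_cover).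
  by count_edges.
- have [x xp Es] := nbs2 Ds pNs;
    have [[xS esx] exs] := mem_nbs_set Es (set22 p x).
  have sx := edge_neq esx.
  have [xq|xq] := eqVneq x q.
    rewrite xq in esx exs Es.
    have := @irr [:: z; p; s] [:: q] isT ltac:(solve_uniq) ltac:(solve_mem)
      (adm3 zp zs ps ezs (cap1 zS) (cap2 pS pn1) (cap1 sS)) ltac:(solve_cover).
    by count_edges.
  have xz : x != z by apply: contraTneq esx => ->.
  have ezx : ~~ edge z x by rewrite (edge_nbs xS Ez) !inE negb_or xp xq.
  have exz : ~~ edge x z by rewrite edgeC.
  have epx : ~~ edge p x by rewrite (edge_nbs xS Ep) !inE negb_or xz eq_sym sx.
  have exp : ~~ edge x p by rewrite edgeC.
  have esq : ~~ edge s q by rewrite (edge_nbs qS Es) !inE negb_or qp eq_sym xq.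
  have eqs' : ~~ edge q s by rewrite eqs.
  have fx := A_range xS; have dx := dg_pos sS exs.
  have sNx : s \in nbs S x by rewrite in_nbs sS.
  have exq : edge x q = edge q x by rewrite edgeC.
  case: (leqP 2 (dg S x)) => [dx2|dx1].
    have := @irr [:: z; p; s] [:: q; x] isT ltac:(solve_uniq) ltac:(solve_mem)
      (adm3 zp zs ps ezs (cap1 zS) (cap2 pS pn1) (cap1 sS)) ltac:(solve_cover).
    rewrite /= !big_cons !big_nil /= !edgeN; known_edges; rewrite exq.
    case Eqx: (edge q x) exq => exq; last by forget; lia.
    move=> I1; have dq2 : dg S q = 2%N by forget; lia.
    have Dx : dg S x = 2%N by forget; lia.
    have s1 : ~~ is_one (lab s) by apply/negP => /Aone as1; forget; lia.
    have x1 : ~~ is_one (lab x) by apply/negP => /Aone ax1; forget; lia.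
    have xNq : x \in nbs S q by rewrite in_nbs xS.
    have qNx : q \in nbs S x by rewrite in_nbs qS exq.
    have [x' xz' Eq] := nbs2 dq2 zNq.
    have xx' : x' = x by move: xNq; rewrite Eq !inE (negPf xz) => /eqP.
    have [q' qs' Ex] := nbs2 Dx sNx.
    have qq' : q' = q.
      by move: qNx; rewrite Ex !inE eq_sym (negPf sq) => /eqP.
    subst x' q'.
    (* The 5-cycle [z p s x q]. *)
    have := @irr [:: p; s; x; q] [:: z] isT ltac:(solve_uniq) ltac:(solve_mem)
      (@adm4 _ cap p s x q ltac:(solve_uniq) epx epq esq
        (cap1 pS) (cap2 sS s1) (cap2 xS x1) (cap1 qS))
      ltac:(solve_cover).
    by count_edges.
  have Dx : dg S x = 1%N by forget; lia.
  have Ex := nbs1 Dx sNx.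
  have s1 : ~~ is_one (lab s).
    by apply/negP => s1; have := one_nbs_dg sS s1 xS esx; rewrite Dx.
  have := @irr [:: z; p; s; x] [:: q] isT ltac:(solve_uniq) ltac:(solve_mem)
    (@adm4 _ cap z p s x ltac:(solve_uniq) ezs ezx epx
      (cap1 zS) (cap2 pS pn1) (cap2 sS s1) (cap1 xS))
    ltac:(solve_cover).
  by count_edges.
- have s1 : ~~ is_one (lab s) by apply/negP => s1;
    have := one_dg sS s1; rewrite Ds.
  have := @irr [:: z; p] [:: q; s] isT ltac:(solve_uniq) ltac:(solve_mem)
    (adm2 zp (cap1 zS) (cap1 pS)) ltac:(solve_cover).
  rewrite /= !big_cons !big_nil /= !edgeN; known_edges; rewrite eqs.
  case Esq: (edge s q) eqs => eqs; last by forget; lia.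
  move=> I1; have dq2 : dg S q = 2%N by forget; lia.
  have qNs : q \in nbs S s by rewrite in_nbs qS.
  have [s' sz' Eq] := nbs2 dq2 zNq.
  have ss' : s' = s.
    have : s \in nbs S q by rewrite in_nbs sS eqs.
    by rewrite Eq !inE (negPf sz) => /eqP.
  subst s'.
  have [x [xp xq Es]] := nbs3 Ds pNs qNs pq.
  have [[xS esx] exs] := mem_nbs_set Es (subsetP (subsetUr _ _) x (set11 x)).
  have sx := edge_neq esx; have fx := A_range xS; have dx := dg_pos sS exs.
  have xz : x != z by apply: contraTneq esx => ->.
  have ezx : ~~ edge z x by rewrite (edge_nbs xS Ez) !inE negb_or xp xq.
  have exz : ~~ edge x z by rewrite edgeC.
  have epx : ~~ edge p x by rewrite (edge_nbs xS Ep) !inE negb_or xz eq_sym sx.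
  have exp : ~~ edge x p by rewrite edgeC.
  have eqx : ~~ edge q x by rewrite (edge_nbs xS Eq) !inE negb_or xz eq_sym sx.
  have exq : ~~ edge x q by rewrite edgeC.
  (* The 4-cycle [z p s q] is attached to the rest at [s], through [x] only.
     Keeping [p s q] fails just when [x] is an end vertex. *)
  have I2 := @irr [:: p; s; q] [:: z; x] isT ltac:(solve_uniq) ltac:(solve_mem)
    (adm3 ps pq sq epq (cap1 pS) (cap2 sS s1) (cap1 qS)) ltac:(solve_cover).
  have Dx : dg S x = 1%N by move: I2; count_edges.
  have sNx : s \in nbs S x by rewrite in_nbs sS.
  have Ex := nbs1 Dx sNx.
  have := @irr [:: z; p; s; x] [:: q] isT ltac:(solve_uniq) ltac:(solve_mem)
    (@adm4 _ cap z p s x ltac:(solve_uniq) ezs ezx epx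
      (cap1 zS) (cap2 pS pn1) (cap2 sS s1) (cap1 xS))
    ltac:(solve_cover).
  by count_edges.
Qed.

(** Both neighbours [p] and [q] of [z] have degree three.  If they are not
    adjacent, they are discarded and [z] is kept.  Otherwise [z] and [p] are
    kept, extended by the third neighbour [s] of [p] if [s] has no neighbour
    besides [p] and [q]. *)
Lemma no_ones : {in S, forall z, ~~ is_one (lab z)}.
Proof.
move=> z zS; apply/negP => z1; have az := Aone z1; have dz := one_dg zS z1.
have [p [q [pq Ez]]] := nbs2_ex dz.
have [[pS ezp] epz] := mem_nbs_set Ez (set21 p q).
have [[qS ezq] eqz] := mem_nbs_set Ez (set22 p q).
have zp := edge_neq ezp; have zq := edge_neq ezq.
have Dp := one_nbs_dg3 zS z1 pS ezp; have Dq := one_nbs_dg3 zS z1 qS ezq.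
have fp := A_range pS; have fq := A_range qS.
have zNp : z \in nbs S p by rewrite in_nbs zS.
have [epq|epq] := boolP (edge p q); last first.
  have eqp : ~~ edge q p by rewrite edgeC.
  have := @irr [:: z] [:: p; q] isT
    ltac:(solve_uniq) ltac:(solve_mem) (adm1 _ _) ltac:(solve_cover).
  by count_edges.
have eqp : edge q p by rewrite edgeC.
have qNp : q \in nbs S p by rewrite in_nbs qS.
have [s [sz sq Ep]] := nbs3 Dp zNp qNp zq.
have [[sS eps] esp] := mem_nbs_set Ep (subsetP (subsetUr _ _) s (set11 s)).
have ps := edge_neq eps; have zs : z != s by rewrite eq_sym.
have fs := A_range sS; have ds := dg_pos pS esp.
have ezs : ~~ edge z s by rewrite (edge_nbs sS Ez) !inE negb_or sq eq_sym ps.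
have esz : ~~ edge s z by rewrite edgeC.
have eqs : edge q s = edge s q by rewrite edgeC.
have pn1 : ~~ is_one (lab p) by apply: one_nbs_notone ezp.
have [closed_s|open_s] := boolP (nbs S s \subset [set p; q]).
  have Es : nbs S s = nbs S s by [].
  have := @irr [:: z; p; s] [:: q] isT ltac:(solve_uniq) ltac:(solve_mem)
    (adm3 zp zs ps ezs (cap1 zS) (cap2 pS pn1) (cap1 sS)).
  have -> : all (fun y => nbs S y \subset [set x in [:: z; p; s; q]]) [:: z; p; s].
    rewrite /= andbT; apply/and3P; split; [cover_with Ez|cover_with Ep|].
    apply: subset_trans closed_s _; apply/subsetP => x; rewrite !inE.
    by case/orP => ->; rewrite ?orbT.
  move=> /(_ isT); rewrite /= !big_cons !big_nil /= !edgeN; known_edges; rewrite eqs.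
  by forget; lia.
case/subsetPn: open_s => x; rewrite in_nbs !inE negb_or => /andP[xS esx] /andP[xp xq].
have := @irr [:: z; p] [:: q; s] isT ltac:(solve_uniq) ltac:(solve_mem)
  (adm2 zp (cap1 zS) (cap1 pS)) ltac:(solve_cover).
have : (count (edge s) [:: p; q; x] <= dg S s)%N.
  apply: leq_count_dg; first by solve_uniq.
  by move=> y; rewrite !inE => /or3P[] /eqP->.
rewrite /= !big_cons !big_nil /= !edgeN; known_edges; rewrite eqs.
by forget; lia.
Qed.

End RemoveOnes.

(** * Removing vertices with two leaves *)

(** A flatter slope gives smaller weights: for [Free] and [OneLeaf] the affine
    parts touch the same hyperbola, and for [Slim] they agree at degree two. *)
Section Comparison.
Variable R : realFieldType.

Lemma le_large_plain k d : ~~ is_one k -> ~~ is_two k ->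
  (is_slim k -> (d <= 2)%N) ->
  large R k d <= chain R 6 1 6 3 d.
Proof.
case: k => // _ _; last first.
  move=> /(_ isT); case: d => [|[|[|d]]] // _; rewrite /chain /=; lra.
move=> _; case: (leqP 3 d) => [d3|]; last first.
  case: d => [|[|[|d]]] // _; rewrite /chain /=; lra.
rewrite !chain_tail //=; last exact: ltnW.
have d0 : 0 < d.+1%:R :> R by rewrite ltr0n.
rewrite !invfM !mulrA ler_pM2r ?invr_gt0 //; lra.
Qed.

Lemma le_small_large k d : ~~ is_two k -> (is_slim k -> (d <= 2)%N) ->
  small R k d <= large R k d.
Proof.
have d0 : 0 < d.+1%:R :> R by rewrite ltr0n.
case: k => // _; last first.
- move=> /(_ isT); case: d d0 => [|[|[|d]]] // _ _; rewrite /chain /=; lra.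
- move=> _; case: (leqP 4 d) => [d4|]; last first.
    case: d d0 => [|[|[|[|d]]]] // _ _; rewrite /chain /=; lra.
  rewrite !chain_tail //=; last lia.
  rewrite !invfM !mulrA ler_pM2r ?invr_gt0 //; lra.
- move=> _; case: (leqP 5 d) => [d5|]; last first.
    case: d d0 => [|[|[|[|[|d]]]]] // _ _; rewrite /chain /=; lra.
  rewrite !chain_tail //=; last lia.
  rewrite !invfM !mulrA ler_pM2r ?invr_gt0 //; lra.
Qed.

End Comparison.

Section Labelled.
Variables (R : realFieldType) (G : sgraph) (lab : G -> kind).
Implicit Types (S : {set G}) (v w p q s x y z : G).

Let cap v := kcap (lab v).

Lemma attained_le (g g' : G -> nat -> R) S :
  {in S, forall v, g v (dg S v) <= g' v (dg S v)} ->
  attained cap g' S -> attained cap g S.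
Proof.
move=> le_g [F [sF aF leF]]; exists F; split=> //.
by apply: le_trans leF; apply: ler_sum.
Qed.

Lemma attained_large S :
  {in S &, forall v w, is_two (lab v) -> is_slim (lab w) -> ~~ edge v w} ->
  {in S, forall v, is_slim (lab v) -> (dg S v <= 2)%N} ->
  attained cap (fun v => large R (lab v)) S.
Proof.
pose P S := {in S &, forall v w, is_two (lab v) -> is_slim (lab w) -> ~~ edge v w} /\
  {in S, forall v, is_slim (lab v) -> (dg S v <= 2)%N}.
suff main : forall S, P S -> 
    attained cap (fun v => large R (lab v)) S.
  by move=> h1 h2; apply: main.
apply: attained_minimal => [{}S S' sS' [h1 h2]|{}S [h1 h2] mS].
  split=> [v w vS' wS'|v vS' v_slim].
    by apply: h1; apply: (subsetP sS').
  by apply: leq_trans (leq_dg v sS') _; apply: h2 => //; apply: (subsetP sS').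
have n1 := no_ones mS h1 h2; have n2 := no_twos_large mS h1.
case: (mS) => nS _; apply: nS.
apply: attained_le (attained_plain R (cap := cap) _) => v vS.
  by apply: le_large_plain; [apply: n1 | apply: n2 | apply: h2].
by have := n1 v vS; have := n2 v vS; rewrite /cap; case: (lab v).
Qed.

Section RemoveTwos.
Variable S : {set G}.
Hypothesis mS : minimal_failure cap (fun v => small R (lab v)) S.
Hypothesis slim_slim :
  {in S &, forall v w, edge v w -> is_slim (lab v) = is_slim (lab w)}.

Let irr (ys rest : seq G) : ys != [::] -> uniq (ys ++ rest) ->
  all (mem S) (ys ++ rest) -> admissible cap [set y in ys] ->
  all (fun y => nbs S y \subset [set x in ys ++ rest]) ys ->
  (90 * size ys + \sum_(a <- ys ++ rest) 2 * 5 * dg S a <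
   \sum_(a <- ys ++ rest) (A_small (lab a) + 5 * count (edge a) (ys ++ rest)))%N.
Proof. by apply: (irreducible (R := R) (D := D_small)) => //; case. Qed.

Let light v : v \in S -> (dg S v < D_small (lab v))%N.
Proof. by apply: (kind_light (R := R) (N := 90) (m := 5) (A := A_small)) => //; case. Qed.

Let A_range v : ~~ is_slim (lab v) ->
  (A_small (lab v) <= 55)%N && ((A_small (lab v) == 30%N) ||
    (A_small (lab v) == 55%N) || (A_small (lab v) == 44%N)).
Proof. by case: (lab v). Qed.

Let cap1 v : ~~ is_slim (lab v) -> (30 < A_small (lab v))%N -> (0 < cap v)%N.
Proof. by rewrite /cap; case: (lab v). Qed.

Let dg_pos v w : w \in S -> edge v w -> (0 < dg S v)%N.
Proof. by move=> wS evw; rewrite (dg_setD1 _ wS) evw. Qed.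

Let not_slim v w : v \in S -> w \in S -> ~~ is_slim (lab v) -> edge v w ->
  ~~ is_slim (lab w).
Proof. by move=> vS wS nv evw; rewrite -(slim_slim vS wS evw). Qed.

(** In the triangle [z p q], keep [p] and [q]: discarding [z] and the third
    neighbour of [q], if any, is cheap enough. *)
Lemma two_triangle z p q : z \in S -> is_two (lab z) ->
  nbs S z = [set p; q] -> p != q -> edge p q -> (dg S p + dg S q <= 5)%N ->
  (100 < A_small (lab p) + A_small (lab q) + 10)%N -> dg S p = 2%N -> (2 <= dg S q)%N -> False.
Proof.
move=> zS z2 Ez pq epq dpq Apq dp dq.
have az : A_small (lab z) = 30%N by case: (lab z) z2.
have nz : ~~ is_slim (lab z) by case: (lab z) z2.
have [[pS ezp] epz] := mem_nbs_set Ez (set21 p q).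
have [[qS ezq] eqz] := mem_nbs_set Ez (set22 p q).
have zp := edge_neq ezp; have zq := edge_neq ezq.
have np := not_slim zS pS nz ezp; have nq := not_slim zS qS nz ezq.
have fp := A_range np; have fq := A_range nq.
have eqp : edge q p by rewrite edgeC.
have dz : dg S z = 2 by rewrite /dg Ez cards2 pq.
have cp : (0 < cap p)%N by apply: cap1 => //; forget; lia.
have cq : (0 < cap q)%N by apply: cap1 => //; forget; lia.
have zNp : z \in nbs S p by rewrite in_nbs zS.
have zNq : z \in nbs S q by rewrite in_nbs zS.
have pNq : p \in nbs S q by rewrite in_nbs pS.
have [q' qz' Ep] := nbs2 dp zNp.
have qq' : q' = q.
  have : q \in nbs S p by rewrite in_nbs qS.
  by rewrite Ep !inE eq_sym (negPf zq) => /eqP.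
subst q'.
case Dq: (dg S q) dq dpq => [|[|[|[|d]]]] // _ dpq; last by forget; lia.
  have [p' pz' Eq] := nbs2 Dq zNq.
  have pp' : p' = p by move: pNq; rewrite Eq !inE eq_sym (negPf zp) => /eqP.
  subst p'.
  have := irr (ys := [:: p; q]) (rest := [:: z]) isT
    ltac:(solve_uniq) ltac:(solve_mem)
    (adm2 pq cp cq) ltac:(solve_cover).
  by count_edges.
have [s [sz sp Eq]] := nbs3 Dq zNq pNq zp.
have [[sS eqs] esq] := mem_nbs_set Eq (subsetP (subsetUr _ _) s (set11 s)).
have qs := edge_neq eqs; have ns := not_slim qS sS nq eqs;
  have fs := A_range ns.
have ds := dg_pos qS esq.
have ezs : ~~ edge z s by rewrite (edge_nbs sS Ez) !inE negb_or sp eq_sym.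
have esz : ~~ edge s z by rewrite edgeC.
have eps : ~~ edge p s by rewrite (edge_nbs sS Ep) !inE negb_or sz eq_sym.
have esp : ~~ edge s p by rewrite edgeC.
have := irr (ys := [:: p; q]) (rest := [:: z; s]) isT
  ltac:(solve_uniq) ltac:(solve_mem)
  (adm2 pq cp cq) ltac:(solve_cover).
by count_edges.
Qed.

(** The vertex [z] has degree at most two.  A neighbour of degree one is kept
    instead of [z].  Otherwise keeping [z] alone works unless its two neighbours
    are adjacent, or both have degree two and no leaf.  In the
    latter case, a neighbour [p] of [z] is kept, with its other neighbour [s] if
    this has degree at most two. *)
Lemma no_twos_small : {in S, forall z, ~~ is_two (lab z)}.
Proof.
move=> z zS; apply/negP => z2.
have az : A_small (lab z) = 30%N by case: (lab z) z2.
have nz : ~~ is_slim (lab z) by case: (lab z) z2.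
have := light zS; have -> : D_small (lab z) = 3%N by case: (lab z) z2.
case dz: (dg S z) => [|[|[|d]]] // _.
- have Ez := nbs0 dz.
  have := irr (ys := [:: z]) (rest := [::]) isT
    ltac:(solve_uniq) ltac:(solve_mem) (adm1 _ _) ltac:(solve_cover).
  by count_edges.
- have [p Ez] := nbs1_ex dz; have [[pS ezp] epz] := mem_nbs_set Ez (set11 p).
  have zp := edge_neq ezp; have dp := dg_pos zS epz.
  have fp := A_range (not_slim zS pS nz ezp).
  have := irr (ys := [:: z]) (rest := [:: p]) isT
    ltac:(solve_uniq) ltac:(solve_mem) (adm1 _ _) ltac:(solve_cover).
  by count_edges.
have dN w : w \in nbs S z -> (2 <= dg S w)%N.
  rewrite in_nbs => /andP[wS ezw]; have ewz : edge w z by rewrite edgeC.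
  have dw := dg_pos zS ewz; rewrite ltn_neqAle dw andbT; apply/negP => /eqP Dw.
  have zNw : z \in nbs S w by rewrite in_nbs zS.
  have Ew := nbs1 (esym Dw) zNw; have zw := edge_neq ezw.
  have fw := A_range (not_slim zS wS nz ezw).
  have := irr (ys := [:: w]) (rest := [:: z]) isT
    ltac:(solve_uniq) ltac:(solve_mem) (adm1 _ _) ltac:(solve_cover).
  by count_edges.
have [p [q [pq Ez]]] := nbs2_ex dz.
have [[pS ezp] epz] := mem_nbs_set Ez (set21 p q).
have [[qS ezq] eqz] := mem_nbs_set Ez (set22 p q).
have zp := edge_neq ezp; have zq := edge_neq ezq.
have np := not_slim zS pS nz ezp; have nq := not_slim zS qS nz ezq.
have fp := A_range np; have fq := A_range nq.
have dp : (2 <= dg S p)%N by apply: dN; rewrite Ez !inE eqxx.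
have dq : (2 <= dg S q)%N by apply: dN; rewrite Ez !inE eqxx orbT.
have := irr (ys := [:: z]) (rest := [:: p; q]) isT
  ltac:(solve_uniq) ltac:(solve_mem) (adm1 _ _) ltac:(solve_cover).
have eqp : edge q p = edge p q by rewrite edgeC.
rewrite /= !big_cons !big_nil /= !edgeN; known_edges; rewrite eqp.
case Epq: (edge p q) eqp => eqp I1.
  have [dp2|dp3] := leqP (dg S p) 2.
    by apply: (@two_triangle z p q) => //; forget; lia.
  by apply: (@two_triangle z q p) => //; rewrite 1?setUC 1?eq_sym //; forget; lia.
have epq : ~~ edge p q by rewrite Epq.
have dp2 : dg S p = 2 by forget; lia.
have zNp : z \in nbs S p by rewrite in_nbs zS.
have [s sz Ep] := nbs2 dp2 zNp;
  have [[sS eps] esp] := mem_nbs_set Ep (set22 z s).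
have ps := edge_neq eps; have ns := not_slim pS sS np eps;
  have fs := A_range ns.
have sq : s != q by apply: contraNneq epq => <-.
have ds := dg_pos pS esp.
have ezs : ~~ edge z s by rewrite (edge_nbs sS Ez) !inE negb_or sq eq_sym ps.
have esz : ~~ edge s z by rewrite edgeC.
have I2 := irr (ys := [:: p]) (rest := [:: z; s]) isT
  ltac:(solve_uniq) ltac:(solve_mem) (adm1 _ _) ltac:(solve_cover).
have cp : (0 < cap p)%N by apply: cap1 => //; forget; lia.
have cs : (0 < cap s)%N by apply: cap1 => //; move: I2; count_edges.
have pNs : p \in nbs S s by rewrite in_nbs pS.
case Ds: (dg S s) ds I2 => [|[|[|d]]] // _ I2.
- have Es := nbs1 Ds pNs.
  have := irr (ys := [:: p; s]) (rest := [:: z]) isT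
    ltac:(solve_uniq) ltac:(solve_mem)
    (adm2 ps cp cs) ltac:(solve_cover).
  by clear I2; count_edges.
- clear I2; have [x xp Es] := nbs2 Ds pNs;
    have [[xS esx] exs] := mem_nbs_set Es (set22 p x).
  have sx := edge_neq esx; have xz : x != z by apply: contraTneq esx => ->.
  have fx := A_range (not_slim sS xS ns esx); have dx := dg_pos sS exs.
  have epx : ~~ edge p x by rewrite (edge_nbs xS Ep) !inE negb_or xz eq_sym.
  have exp : ~~ edge x p by rewrite edgeC.
  have := irr (ys := [:: p; s]) (rest := [:: z; x]) isT
    ltac:(solve_uniq) ltac:(solve_mem)
    (adm2 ps cp cs) ltac:(solve_cover).
  have exz : edge x z = edge z x by rewrite edgeC.
  rewrite /= !big_cons !big_nil /= !edgeN; known_edges; rewrite exz.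
  by forget; lia.
by move: I2; count_edges.
Qed.

End RemoveTwos.

Lemma attained_small S :
  {in S &, forall v w, edge v w -> is_slim (lab v) = is_slim (lab w)} ->
  {in S, forall v, is_slim (lab v) -> (dg S v <= 2)%N} ->
  attained cap (fun v => small R (lab v)) S.
Proof.
pose P S := {in S &, forall v w, edge v w -> is_slim (lab v) = is_slim (lab w)} /\
  {in S, forall v, is_slim (lab v) -> (dg S v <= 2)%N}.
suff main : forall S, P S -> 
    attained cap (fun v => small R (lab v)) S.
  by move=> h1 h2; apply: main.
apply: attained_minimal => [{}S S' sS' [h1 h2]|{}S [h1 h2] mS].
  split=> [v w vS' wS'|v vS' v_slim].
    by apply: h1; apply: (subsetP sS').
  by apply: leq_trans (leq_dg v sS') _; apply: h2 => //; apply: (subsetP sS').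
have n2 := no_twos_small mS h1.
case: (mS) => nS _; apply: nS.
apply: attained_le (attained_large (S := S) _ h2) => [v vS|v w vS _ v2].
  by apply: le_small_large; [apply: n2 | apply: h2].
by have := n2 v vS; rewrite v2.
Qed.

End Labelled.

(** * The function f_eps and the weights of the kinds *)

Arguments f_eps {R} eps d : simpl never.

Section Feps.
Variables (R : realType) (eps : R).
Hypothesis eps_bounds : 0 <= eps <= 1 / 6.

Lemma f_eps_ge3 D : (3 <= D)%N -> f_eps eps D = Num.min (3 * eps) (2 / D.+1%:R).
Proof.
by case: D => [|[|[|D]]] // _; congr (Num.min _ (_ / _)); rewrite natr1.
Qed.

Lemma f_eps_le_eps D : (3 <= D)%N -> f_eps eps D <= 3 * eps.
Proof. by move=> /f_eps_ge3->; rewrite ge_min lexx. Qed.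

Lemma f_eps_le_inv D : (3 <= D)%N -> f_eps eps D <= 2 / D.+1%:R.
Proof. by move=> /f_eps_ge3->; rewrite ge_min lexx orbT. Qed.

Let mix1 (f e b : R) : f <= 3 * e -> f <= b -> f - e <= 2 / 3 * b.
Proof. lra. Qed.

Let mix2 (f e b : R) : f <= 3 * e -> f <= b -> f - 2 * e <= 1 / 3 * b.
Proof. lra. Qed.

Let tail_small (x : R) : 0 <= x -> x <= 5 ->
  1 / 3 * (2 / (x + 1 + 1 + 1)) <= (1 / 2) / (x + 1).
Proof.
move=> x0 x5; have x1 : 0 < x + 1 by lra.
have x3 : 0 < x + 1 + 1 + 1 by lra.
by rewrite mulrA ler_pdivrMr // [X in _ <= X]mulrAC ler_pdivlMr //; lra.
Qed.

Let tail_large (x : R) : 6 <= x ->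
  2 / (x + 1 + 1 + 1) <= (1 / 2) / (x + 1) + 1 / 6.
Proof.
move=> x6; have x1 : 0 < x + 1 by lra.
have x3 : 0 < x + 1 + 1 + 1 by lra.
have -> : (1 / 2) / (x + 1) + 1 / 6 = (x + 4) / (6 * (x + 1)).
  by field; rewrite lt0r_neq0.
rewrite ler_pdivrMr // [X in _ <= X]mulrAC ler_pdivlMr; last by rewrite mulr_gt0.
nra.
Qed.

Lemma f_eps_ge0 D : 0 <= f_eps eps D.
Proof.
case/andP: eps_bounds => e0 e6; case: D => [|[|[|D]]]; rewrite /f_eps; [lra..|].
rewrite le_min; apply/andP; split; first lra.
by rewrite divr_ge0 // addr_ge0 // ler0n.
Qed.

Lemma f_eps_anti D : f_eps eps D.+1 <= f_eps eps D.
Proof.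
case/andP: eps_bounds => e0 e6; case: D => [|[|[|D]]]; [rewrite /f_eps; lra..| |].
  by have := @f_eps_le_eps 3 isT; rewrite /f_eps; lra.
rewrite !f_eps_ge3 // le_min !ge_min lexx /= orbC.
by rewrite ler_pM2l // lef_pV2 ?posrE // ler_nat leqnSn.
Qed.

Lemma f_eps_le1 D : f_eps eps D <= 1.
Proof. by elim: D => // D; apply: le_trans; apply: f_eps_anti. Qed.

Definition kind_of (l D : nat) : kind :=
  match l with
  | 0 => if D == 2%N then Slim else Free
  | 1 => OneLeaf
  | _ => TwoLeaves
  end.

(** A leaf weighs [1 - eps] and is always kept, so its neighbour can be charged
    [eps] less.  As a function of [eps], the difference [f_eps eps D - l * eps]
    increases until [3 * eps = 2 / D.+1] and decreases afterwards. *)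
Lemma f_eps_le_large l d : 1 / 12 <= eps -> (l <= 2)%N -> (2 <= l + d)%N ->
  ((0 < l) ==> (3 <= l + d))%N ->
  f_eps eps (l + d) <=
    large R (kind_of l (l + d)) d + eps * l%:R.
Proof.
case/andP: eps_bounds => e0 e6 e12.
case: l => [|[|[|//]]] _ /=; rewrite ?add0n ?mulr0 ?mulr1 ?addr0.
- move=> d2 _; case: eqP => [->|d2']; first by rewrite /chain /f_eps /=; lra.
  have d3 : (3 <= d)%N by lia.
  apply: le_trans (f_eps_le_inv d3) _; rewrite chain_tail //=.
  have d0 : 0 < d.+1%:R :> R by rewrite ltr0n.
  by rewrite !invfM !mulrA ler_pM2r ?invr_gt0 //; lra.
- rewrite add1n => _ d2; rewrite chain_tail //=.
  have d0 : 0 < d.+1%:R :> R by rewrite ltr0n.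
  rewrite -lerBlDr.
  have d1 : 0 < d.+2%:R :> R by rewrite ltr0n.
  have le1 := f_eps_le_eps d2; have le2 := f_eps_le_inv d2.
  have : f_eps eps d.+1 - eps <= 2 / 3 * (2 / d.+2%:R) by apply: mix1.
  move/le_trans; apply; rewrite !invfM.
  have : d.+2%:R^-1 <= d.+1%:R^-1 :> R by rewrite lef_pV2 ?posrE // ler_nat.
  by move: (d.+2%:R^-1) (d.+1%:R^-1) => a b; lra.
- rewrite add2n => _ d1; case: (leqP 2 d) => [d2|d2]; last first.
    have -> : d = 1%N by lia.
    by have := @f_eps_le_eps 3 isT; rewrite /chain /=; lra.
  rewrite chain_tail //=.
  have le1 := @f_eps_le_eps d.+2 d1; have le2 := @f_eps_le_inv d.+2 d1.
  have d0 : 0 <= d%:R :> R by [].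
  rewrite -[d.+3%:R]natr1 -[d.+2%:R]natr1 -[d.+1%:R]natr1 in le1 le2 *.
  have e1 : d%:R + 1 > 0 :> R by lra.
  have e3 : d%:R + 1 + 1 + 1 > 0 :> R by lra.
  have -> : 2 * (13 - 4 * 1) / (36 * (d%:R + 1)) = (1 / 2) / (d%:R + 1) :> R.
    by field; rewrite lt0r_neq0.
  (* The two bounds on [f_eps] are used at [3 * eps = 2 / d.+3], and at
     [eps = 1 / 12]; both meet the hyperbola at [d = 5]. *)
  case: (leqP d 5) => [d5|d6].
    have : f_eps eps d.+2 - 2 * eps <= 1 / 3 * (2 / (d%:R + 1 + 1 + 1)) by apply: mix2.
    have d5' : d%:R <= 5 :> R by rewrite (ler_nat R d 5).
    by have := tail_small d0 d5'; lra.
  have d6' : 6 <= d%:R :> R by rewrite (ler_nat R 6 d).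
  by have := tail_large d6'; lra.
Qed.

Lemma f_eps_le_small l d : eps <= 1 / 12 -> (l <= 2)%N -> (2 <= l + d)%N ->
  ((0 < l) ==> (3 <= l + d))%N ->
  f_eps eps (l + d) <=
    small R (kind_of l (l + d)) d + eps * l%:R.
Proof.
case/andP: eps_bounds => e0 e6 e12.
case: l => [|[|[|//]]] _ /=; rewrite ?add0n ?mulr0 ?mulr1 ?addr0.
- move=> d2 _; case: eqP => [->|d2']; first by rewrite /chain /f_eps /=; lra.
  have d3 : (3 <= d)%N by lia.
  case: (leqP 5 d) => [d5|d5]; last first.
    have := f_eps_le_eps d3.
    by case: d d3 d5 {d2 d2'} => [|[|[|[|[|d]]]]] // _ _; rewrite /chain /=; lra.
  apply: le_trans (f_eps_le_inv d3) _; rewrite chain_tail //=.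
  have d0 : 0 < d.+1%:R :> R by rewrite ltr0n.
  by rewrite !invfM !mulrA ler_pM2r ?invr_gt0 //; lra.
- rewrite add1n => _ d2; case: (leqP 4 d) => [d4|d4]; last first.
    have := f_eps_le_eps d2.
    by case: d d2 d4 => [|[|[|[|d]]]] // _ _; rewrite /chain /=; lra.
  rewrite chain_tail //=.
  have d0 : 0 < d.+1%:R :> R by rewrite ltr0n.
  have d1 : 0 < d.+2%:R :> R by rewrite ltr0n.
  have le1 := f_eps_le_eps d2; have le2 := f_eps_le_inv d2.
  have : f_eps eps d.+1 - eps <= 2 / 3 * (2 / d.+2%:R) by apply: mix1.
  rewrite lerBlDr; move/le_trans; apply; rewrite lerD2r !invfM.
  have : d.+2%:R^-1 <= d.+1%:R^-1 :> R by rewrite lef_pV2 ?posrE // ler_nat.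
  by move: (d.+2%:R^-1) (d.+1%:R^-1) => a b; lra.
- rewrite add2n => _ d1; case: (leqP 2 d) => [d2|d2]; last first.
    have := f_eps_le_eps d1.
    by case: d d1 d2 => [|[|d]] // _ _; rewrite /chain /=; lra.
  rewrite chain_tail //=.
  have d0 : 0 < d.+1%:R :> R by rewrite ltr0n.
  have le1 := f_eps_le_eps d1; have le2 := f_eps_le_inv d1.
  have : f_eps eps d.+2 - 2 * eps <= 1 / 3 * (2 / d.+3%:R) by apply: mix2.
  rewrite [eps * _]mulrC lerBlDr; move/le_trans; apply; rewrite lerD2r !invfM.
  have : d.+3%:R^-1 <= d.+1%:R^-1 :> R by rewrite lef_pV2 ?posrE // ler_nat; lia.
  by move: (d.+3%:R^-1) (d.+1%:R^-1) => a b; lra.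
Qed.

End Feps.

(** * The lower bound *)

Section Main.
Variables (R : realType) (eps : R).
Hypothesis eps_bounds : 0 <= eps <= 1 / 6.
Variable G : sgraph.
Implicit Types (u v w b c x y : G).

Let cap (v : G) := 2%N.
Let f (v : G) := f_eps eps.

Section Minimal.
Variable S : {set G}.
Hypothesis mS : minimal_failure cap f S.

Let e0 : 0 <= eps. Proof. by case/andP: eps_bounds. Qed.
Let e6 : eps <= 1 / 6. Proof. by case/andP: eps_bounds. Qed.

Lemma minimal_keep_feps (ys rest : seq G) :
  ys ++ rest != [::] -> uniq (ys ++ rest) -> all (mem S) (ys ++ rest) ->
  admissible cap [set y in ys] ->
  all (fun y => nbs S y \subset [set x in ys ++ rest]) ys ->
  (size ys)%:R < \sum_(a <- ys ++ rest) f_eps eps (dg S a).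
Proof.
move=> ne us /allP sS ays /allP nys.
have -> : \sum_(a <- ys ++ rest) f_eps eps (dg S a) =
          \sum_(a in [set x in ys ++ rest]) f a (dg S a).
  by rewrite big_uniq //=; apply: eq_bigl => a; rewrite inE.
have <- : #|[set y in ys]| = size ys.
  by rewrite cardsE; apply/card_uniqP; move: us; rewrite cat_uniq => /andP[].
apply: (minimal_keep_antitone (fun _ => f_eps_anti eps_bounds) mS) => //.
- by apply/subsetP => y; rewrite !inE mem_cat => ->.
- by apply/subsetP => y; rewrite inE => /sS.
- apply/set0Pn; move: ne; case: (ys ++ rest) => // a s _.
  by exists a; rewrite inE mem_head.
- by move=> y; rewrite inE; apply: nys.
Qed.

Lemma feps_no_isolated v : v \in S -> (0 < dg S v)%N.
Proof.
move=> vS; rewrite lt0n; apply/eqP => dv; have Ev := nbs0 dv.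
have := @minimal_keep_feps [:: v] [::] isT
  ltac:(solve_uniq) ltac:(solve_mem) (adm1 _ _) ltac:(solve_cover).
by rewrite big_seq1 dv /f_eps ltxx.
Qed.

Lemma feps_drop_low u : (0 < dg S u <= 2)%N ->
  eps <= f_eps eps (dg S u).-1 - f_eps eps (dg S u).
Proof. by have := e6; case: (dg S u) => [|[|[|d]]] //= h _; rewrite /f_eps; lra. Qed.

(** Three neighbours of degree at most two each gain at least [eps] when [b]
    is deleted, and [b] itself weighs at most [3 * eps]. *)
Lemma feps_few_low b : b \in S -> (3 <= dg S b)%N ->
  (#|[set u in nbs S b | dg S u <= 2]| <= 2)%N.
Proof.
move=> bS db; rewrite leqNgt; apply/negP => low3.
have := minimal_delete mS bS; apply/negP; rewrite -leNgt.
apply: le_trans (f_eps_le_eps eps db) _.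
rewrite (big_setID [set u in nbs S b | dg S u <= 2]%N) /= (setIidPr _); last first.
  by apply/subsetP => u; rewrite inE => /andP[].
rewrite -[3 * eps]addr0 lerD //; last first.
  apply: sumr_ge0 => u; rewrite !inE => /and3P[_ uS ebu].
  rewrite subr_ge0; case: (dg S u) => //= d; exact: f_eps_anti.
apply: (@le_trans _ _ (\sum_(u in [set u in nbs S b | dg S u <= 2]%N) eps)).
  rewrite sumr_const -[X in _ <= X]mulr_natl ler_wpM2r //.
  by rewrite (ler_nat R 3).
apply: ler_sum => u; rewrite !inE => /andP[/andP[uS ebu] du].
by apply: feps_drop_low; rewrite du andbT feps_no_isolated.
Qed.

Lemma feps_no_two b u : eps <= 1 / 12 -> b \in S -> u \in S -> edge b u ->
  (3 <= dg S b)%N -> dg S u != 2.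
Proof.
move=> e12 bS uS ebu db; apply/eqP => du.
have := minimal_delete mS bS; apply/negP; rewrite -leNgt.
apply: le_trans (f_eps_le_eps eps db) _.
have uN : u \in nbs S b by rewrite in_nbs uS.
rewrite (big_setD1 u uN) /= /f du -[3 * eps]addr0 lerD //.
  by rewrite /f_eps /=; lra.
apply: sumr_ge0 => w _; rewrite subr_ge0; case: (dg S w) => //= d.
exact: f_eps_anti.
Qed.

(** A path hanging off the rest of the graph is kept, and cut off at the first
    vertex where this is cheap. *)
Lemma feps_leaf_nbs u x : u \in S -> x \in S -> edge u x -> dg S x = 1%N ->
  dg S u != 2.
Proof.
move=> uS xS eux dx; apply/eqP => du.
have exu : edge x u by rewrite edgeC.
have uNx : u \in nbs S x by rewrite in_nbs uS.
have xNu : x \in nbs S u by rewrite in_nbs xS.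
have Ex := nbs1 dx uNx; have [b bx Eu] := nbs2 du xNu.
have [[bS eub] ebu] := mem_nbs_set Eu (set22 x b).
have ub := edge_neq eub; have xu := edge_neq exu.
have xb : x != b by rewrite eq_sym.
have exb : ~~ edge x b by rewrite (edge_nbs bS Ex) inE eq_sym.
have uNb : u \in nbs S b by rewrite in_nbs uS.
have := feps_no_isolated bS; case Db: (dg S b) => [|[|[|d]]] // _.
- have Eb := nbs1 Db uNb.
  have := @minimal_keep_feps [:: x; u; b] [::] isT
    ltac:(solve_uniq) ltac:(solve_mem)
    (adm3 (cap := cap) xu xb ub exb isT isT isT) ltac:(solve_cover).
  rewrite /= !big_cons big_nil dx du Db /f_eps /=; have := e0; lra.
- have [c cu Eb] := nbs2 Db uNb.
  have [[cS ebc] ecb] := mem_nbs_set Eb (set22 u c).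
  have bc := edge_neq ebc; have xc : x != c.
    by apply: contraTneq ecb => <-.
  have exc : ~~ edge x c by rewrite (edge_nbs cS Ex) inE.
  have euc : ~~ edge u c by rewrite (edge_nbs cS Eu) !inE negb_or eq_sym xc eq_sym.
  have bNc : b \in nbs S c by rewrite in_nbs bS.
  have := feps_no_isolated cS; case Dc: (dg S c) => [|[|d]] // _.
    have Ec := nbs1 Dc bNc.
    have := @minimal_keep_feps [:: x; u; b; c] [::] isT
      ltac:(solve_uniq) ltac:(solve_mem)
      (@adm4 _ cap x u b c ltac:(solve_uniq) exb exc euc isT isT isT isT)
      ltac:(solve_cover).
    rewrite /= !big_cons big_nil dx du Db Dc /f_eps /=; have := e0; lra.
  have := @minimal_keep_feps [:: x; u; b] [:: c] isT
    ltac:(solve_uniq) ltac:(solve_mem)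
    (adm3 (cap := cap) xu xb ub exb isT isT isT) ltac:(solve_cover).
  have fc : f_eps eps (dg S c) <= 2 / 3.
    rewrite Dc.
    exact: (@leq_antitone R G f (fun _ => f_eps_anti eps_bounds) x 2 d.+2).
  by rewrite /= !big_cons big_nil dx du Db; move: (f_eps eps (dg S c)) fc => t;
    rewrite /f_eps /=; have := e0; lra.
have := @minimal_keep_feps [:: x; u] [:: b] isT
  ltac:(solve_uniq) ltac:(solve_mem)
  (adm2 (cap := cap) xu isT isT) ltac:(solve_cover).
have fb : f_eps eps (dg S b) <= 3 * eps by apply: f_eps_le_eps; rewrite Db.
by rewrite /= !big_cons big_nil dx du; move: (f_eps eps (dg S b)) fb => t;
   rewrite /f_eps /=; have := e6; lra.
Qed.

Let L := [set v in S | dg S v == 1%N].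
Let H := S :\: L.
Let lab v := kind_of (dg L v) (dg S v).

Let sLS : L \subset S. Proof. by apply/subsetP => v; rewrite inE => /andP[]. Qed.

Let sHS : H \subset S. Proof. exact: subsetDl. Qed.

Let dgSE v : dg S v = (dg L v + dg H v)%N. Proof. exact: dgD. Qed.

Let dgH2 v : v \in H -> (2 <= dg S v)%N.
Proof.
rewrite !inE => /andP[nL vS]; move: nL; rewrite vS /= => d1.
by have := feps_no_isolated vS; lia.
Qed.

Let leafy v : v \in H -> (0 < dg L v)%N -> (3 <= dg S v)%N.
Proof.
move=> vH; rewrite card_gt0 => /set0Pn[x]; rewrite in_nbs inE.
move=> /andP[/andP[xS /eqP dx] evx].
have := feps_leaf_nbs (subsetP sHS v vH) xS evx dx; have := dgH2 vH; lia.
Qed.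

Let low_sub v : nbs L v \subset [set u in nbs S v | dg S u <= 2]%N.
Proof.
apply/subsetP => u; rewrite in_nbs [u \in L]inE => /andP[/andP[uS /eqP du] evu].
by rewrite !inE uS evu du.
Qed.

Let dgL2 v : v \in H -> (dg L v <= 2)%N.
Proof.
move=> vH; have [->//|pos] := posnP (dg L v).
have vS := subsetP sHS v vH.
exact: leq_trans (subset_leq_card (low_sub v)) (feps_few_low vS (leafy vH pos)).
Qed.

Let slimP v : v \in H -> is_slim (lab v) = (dg S v == 2).
Proof.
move=> vH; rewrite /lab; have := leafy vH; have := dgH2 vH.
case: (dg L v) => [|[|l]] /= d2 d3; first by case: ifP.
  by have := d3 isT; lia.
by have := d3 isT; lia.
Qed.

Let slim_dgH : {in H, forall v, is_slim (lab v) -> (dg H v <= 2)%N}.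
Proof.
move=> v vH; rewrite slimP // => /eqP d2.
by apply: leq_trans (leq_dg v sHS) _; rewrite d2.
Qed.

Let two_slimH : {in H &, forall v w, is_two (lab v) -> is_slim (lab w) -> ~~ edge v w}.
Proof.
move=> v w vH wH v2; rewrite slimP // => /eqP dw; apply/negP => evw.
have wS := subsetP sHS w wH; have vS := subsetP sHS v vH.
have l2 : (2 <= dg L v)%N.
  by move: v2; rewrite /lab; case: (dg L v) => [|[|l]] //=; case: ifP.
have d3 : (3 <= dg S v)%N by apply: leafy => //; apply: ltnW.
have := feps_few_low vS d3; apply/negP; rewrite -ltnNge.
apply: (@leq_trans #|w |: nbs L v|).
  rewrite cardsU1 -/(dg L v) (_ : w \notin nbs L v) //.
  by rewrite in_nbs inE dw andbF.
apply: subset_leq_card; rewrite subUset low_sub andbT sub1set.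
by rewrite !inE wS evw dw.
Qed.

Let slim_slimH : eps <= 1 / 12 ->
  {in H &, forall v w, edge v w -> is_slim (lab v) = is_slim (lab w)}.
Proof.
move=> e12 v w vH wH evw; rewrite !slimP //.
have wS := subsetP sHS w wH; have vS := subsetP sHS v vH.
have ewv : edge w v by rewrite edgeC.
have dv := dgH2 vH; have dw := dgH2 wH.
case: (ltnP 2 (dg S v)) => dv2; case: (ltnP 2 (dg S w)) => dw2.
- by rewrite !gtn_eqF.
- by rewrite gtn_eqF // (negbTE (feps_no_two e12 vS wS evw dv2)).
- by rewrite [RHS]gtn_eqF // (negbTE (feps_no_two e12 wS vS ewv dw2)).
- by rewrite !eqn_leq dv dv2 dw dw2.
Qed.

(** A vertex of [F] gains as many neighbours as its capacity lies below two. *)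
Let extend_leaves (F : {set G}) : F \subset H -> admissible (fun v => kcap (lab v)) F ->
  admissible cap (F :|: L).
Proof.
move=> sFH [cF aF]; have sFL : F :|: L \subset S.
  by rewrite subUset sLS (subset_trans sFH sHS).
split=> [v|C sC C0].
  rewrite inE; case: (boolP (v \in L)) => [|_]; last rewrite orbF => vF.
    by rewrite inE => /andP[_ /eqP dv] _; apply: leq_trans (leq_dg v sFL) _; rewrite dv.
  have vH := subsetP sFH v vF.
  have -> : dg (F :|: L) v = (dg L v + dg F v)%N.
    rewrite (@dgD _ (F :|: L) L) ?subsetUr //; congr (_ + dg _ v)%N.
    apply/setP => y; rewrite !inE; case: (boolP (y \in F)) => [yF|yF] /=.
      by have := subsetP sFH y yF; rewrite !inE => /andP[-> _].
    by rewrite andNb.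
  have := cF v vF; have := dgL2 vH; rewrite /lab /cap.
  move: (dg F v) (dg L v) (dg S v); clear => d l D.
  by case: l => [|[|[|l]]] //=; case: ifP => _ /=; lia.
have [CL0|] := eqVneq (C :&: L) set0.
  apply: aF => //; apply/subsetP => y yC; have := subsetP sC y yC.
  rewrite inE => /orP[//|yL]; have := in_set0 y.
  by rewrite -CL0 inE yC yL.
case/set0Pn => y; rewrite !inE => /and3P[yC yS /eqP dy]; exists y => //.
by rewrite -dy; apply: leq_dg; apply: subset_trans sC sFL.
Qed.

Let card_leaves : (\sum_(v in H) dg L v <= #|L|)%N.
Proof.
rewrite sum_dg -sum1_card; apply: leq_sum => v.
by rewrite inE => /andP[_ /eqP <-]; apply: leq_dg.
Qed.

(** Every leaf has at most one neighbour in [H], so the vertices of [H] are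
    charged at most [eps * #|L|] in total, which is what the leaves lack. *)
Lemma feps_no_minimal : False.
Proof.
case: (mS) => nS _; apply: nS.
pose g (v : G) d : R := f_eps eps (dg L v + d) - eps * (dg L v)%:R.
have Hok v : v \in H -> [/\ (dg L v <= 2)%N, (2 <= dg L v + dg H v)%N &
    ((0 < dg L v) ==> (3 <= dg L v + dg H v))%N].
  move=> vH; rewrite -dgSE; split; [exact: dgL2 | exact: dgH2 |].
  by apply/implyP; apply: leafy.
have [F [sF aF leF]] : attained (fun v => kcap (lab v)) g H.
  case: (lerP eps (1 / 12)) => [e12|/ltW e12].
    apply: attained_le (attained_small (lab := lab) R (slim_slimH e12) slim_dgH).
    move=> v /Hok[h1 h2 h3]; rewrite /g lerBlDr /lab dgSE.
    exact: f_eps_le_small.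
  apply: attained_le (attained_large (lab := lab) R two_slimH slim_dgH).
  move=> v /Hok[h1 h2 h3]; rewrite /g lerBlDr /lab dgSE.
  exact: f_eps_le_large.
have aFL := extend_leaves sF aF.
exists (F :|: L); split=> //; first by rewrite subUset sLS (subset_trans sF sHS).
have -> : #|F :|: L|%:R = #|F|%:R + #|L|%:R :> R.
  rewrite -natrD cardsU (_ : F :&: L = set0) ?cards0 ?subn0 //.
  apply/setP => y; rewrite !inE; apply/negP => /andP[/(subsetP sF)].
  by rewrite !inE => /andP[/negbTE ->].
rewrite /wt (big_setID L) /= (setIidPr sLS) -/H.
have -> : \sum_(v in L) f v (dg S v) = #|L|%:R - eps * #|L|%:R.
  rewrite (eq_bigr (fun=> 1 - eps)).
    by rewrite sumr_const -[LHS]mulr_natl mulrBr mulr1 [X in _ - X]mulrC.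
  by move=> v; rewrite inE => /andP[_ /eqP dv]; rewrite /f dv.
have -> : \sum_(v in H) f v (dg S v) = wt g H + eps * (\sum_(v in H) dg L v)%:R.
  rewrite natr_sum mulr_sumr -big_split; apply: eq_bigr => v _.
  by rewrite /g /f /= subrK dgSE.
have : eps * (\sum_(v in H) dg L v)%:R <= eps * #|L|%:R.
  by rewrite ler_wpM2l // ler_nat.
move: leF (_ * _) (_ * _) => + a b; lra.
Qed.

End Minimal.

Lemma attained_feps S : attained cap f S.
Proof.
apply: (@attained_minimal R G cap f (fun _ => True)) => // {}S _ mS.
exact: feps_no_minimal mS.
Qed.

End Main.

(** * Upper bounds from complete graphs and claws *)

Section Complete.
Variable n : nat.

Definition complete_edge : rel 'I_n := fun i j => i != j.

Lemma complete_edge_sym : symmetric complete_edge.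
Proof. by move=> i j; rewrite /complete_edge eq_sym. Qed.

Lemma complete_edge_irrefl : irreflexive complete_edge.
Proof. by move=> i; rewrite /complete_edge eqxx. Qed.

Definition complete := SGraph complete_edge_sym complete_edge_irrefl.

Lemma deg_complete (v : complete) : deg v = n.-1.
Proof.
rewrite /deg -[in RHS](card_ord n) -(cardC1 v); apply: eq_card => w.
by rewrite inE !inE eq_sym.
Qed.

Lemma alpha_complete : (alpha linear_forest complete <= 2)%N.
Proof.
apply: alpha_leq => S lfS; rewrite leqNgt; apply/negP => /card_gt2P.
move=> [x [y [z [[xS yS zS] [xy yz zx]]]]].
exact: (linear_forest_triangle lfS xS yS zS).
Qed.

End Complete.

Section Claws.
Variable m : nat.

(** A complete graph on the vertices [(i, 0)], each of which carries the three
    leaves [(i, 1)], [(i, 2)] and [(i, 3)]. *)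
Definition claw_edge : rel ('I_m * 'I_4) := fun u v =>
  if (u.2 == ord0) && (v.2 == ord0) then u.1 != v.1
  else (u.1 == v.1) && ((u.2 == ord0) (+) (v.2 == ord0)).

Lemma claw_edge_sym : symmetric claw_edge.
Proof.
by move=> u v; rewrite /claw_edge andbC addbC (eq_sym u.1).
Qed.

Lemma claw_edge_irrefl : irreflexive claw_edge.
Proof. by move=> u; rewrite /claw_edge addbb !eqxx andbF; case: ifP. Qed.

Definition claws := SGraph claw_edge_sym claw_edge_irrefl.

Lemma sum_claws (F : 'I_m -> 'I_4 -> nat) :
  (\sum_(v : claws) F v.1 v.2 = \sum_i \sum_a F i a)%N.
Proof. by rewrite pair_big. Qed.

Lemma deg_claws (v : claws) : deg v = if v.2 == ord0 then (m.-1 + 3)%N else 1%N.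
Proof.
have -> : deg v = dg [set: claws] v by rewrite /deg /dg; apply: eq_card => w; rewrite !inE.
case: v => i a; rewrite dgE /= (eq_bigl xpredT) => [|w]; last by rewrite inE.
rewrite (sum_claws (fun j b => claw_edge (i, a) (j, b))) /claw_edge /=.
have sum_eq : (\sum_(j < m) (i == j) = 1)%N.
  by rewrite (bigD1 i) //= eqxx big1 // => j; rewrite eq_sym => /negPf ->.
have sum_neq : (\sum_(j < m) (i != j) = m.-1)%N.
  have : (\sum_(j < m) ((i == j) + (i != j)) = m)%N.
    rewrite -[RHS]card_ord -sum1_card; apply: eq_bigr => j _; by case: (i == j).
  by rewrite big_split /= sum_eq; lia.
case: eqP => a0.
  rewrite (eq_bigr (fun j : 'I_m => (i != j) + 3 * (i == j))%N) => [|j _].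
    by rewrite big_split /= -big_distrr /= sum_eq sum_neq.
  by rewrite !big_ord_recl big_ord0 /=; case: (i == j).
rewrite -[RHS]sum_eq; apply: eq_bigr => j _.
by rewrite !big_ord_recl big_ord0 /=; case: (i == j).
Qed.

Lemma alpha_claws : (alpha linear_forest claws <= 3 * m)%N.
Proof.
apply: alpha_leq => S lfS.
have -> : #|S| = (\sum_(v : claws) (v \in S))%N.
  by rewrite -sum1_card big_mkcond; apply: eq_bigr => v _; case: (v \in S).
rewrite (eq_bigr (fun v : claws => ((v.1, v.2) \in S : nat))) => [|[i a] //].
rewrite (sum_claws (fun i a => ((i, a) \in S : nat))).
have -> : (3 * m = \sum_(i < m) 3)%N by rewrite big_const_ord iter_addn_0.
apply: leq_sum => i _; rewrite !big_ord_recl big_ord0.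
set a1 := lift _ _; set a2 := lift _ _; set a3 := lift _ _.
case c0: ((i, ord0) \in S); case c1: ((i, a1) \in S); case c2: ((i, a2) \in S);
  case c3: ((i, a3) \in S) => //.
have := linear_forest_dg lfS c0; rewrite leqNgt => /negP[].
apply: (@leq_trans (count (@edge claws (i, ord0)) [:: (i, a1); (i, a2); (i, a3)])).
  by rewrite /= /claw_edge /= !eqxx.
apply: leq_count_dg; first by rewrite /= !inE !xpair_eqE !eqxx.
by move=> y; rewrite !inE => /or3P[] /eqP->.
Qed.

End Claws.

Section Bounds.
Variable R : realType.
Implicit Types (f : nat -> R) (eps : R).

Lemma lower_bound_complete f : lower_bound linear_forest f ->
  forall d, f d <= 2 / d.+1%:R.
Proof.
move=> [_ lbf] d; have := lbf (complete d.+1).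
rewrite (eq_bigr (fun=> f d)) => [|v _]; last by rewrite deg_complete.
rewrite sumr_const card_ord ler_pdivlMr ?ltr0n // mulr_natr => /le_trans; apply.
by rewrite (ler_nat R _ 2) alpha_complete.
Qed.

(** The claws over a complete graph on [d - 2] vertices: the centres have degree
    [d]. *)
Lemma lower_bound_claws f : lower_bound linear_forest f ->
  forall d, (3 <= d)%N -> f d + 3 * f 1%N <= 3.
Proof.
move=> [_ lbf] d d3; pose m := (d - 2)%N.
have dE : d = (m.-1 + 3)%N by rewrite /m; lia.
have m0 : 0 < m%:R :> R by rewrite ltr0n /m; lia.
have := lbf (claws m).
rewrite (eq_bigr (fun v : claws m => if v.2 == ord0 then f d else f 1%N)); last first.
  by move=> v _; rewrite deg_claws -dE; case: ifP.
have -> : \sum_(v : claws m) (if v.2 == ord0 then f d else f 1%N) =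
    \sum_(i < m) \sum_(a < 4) (if a == ord0 then f d else f 1%N).
  by rewrite pair_big.
rewrite (eq_bigr (fun=> f d + 3 * f 1%N)) => [|i _]; last first.
  by rewrite !big_ord_recl big_ord0 /=; ring.
rewrite sumr_const card_ord => le_sum; rewrite -(ler_pM2r m0) [X in X <= _]mulr_natr.
by apply: le_trans le_sum _; rewrite -natrM (ler_nat R) alpha_claws.
Qed.

Lemma f_eps_lower_bound eps : 0 <= eps <= 1 / 6 ->
  lower_bound linear_forest (f_eps eps).
Proof.
move=> eps_b; split=> [d|G].
  by rewrite f_eps_ge0 // f_eps_le1.
have [F [_ aF leF]] := attained_feps eps_b [set: G].
have -> : \sum_(v : G) f_eps eps (deg v) =
    \sum_(v in [set: G]) f_eps eps (dg [set: G] v).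
  apply: eq_big => [v|v _]; first by rewrite inE.
  by congr f_eps; rewrite /deg /dg; apply: eq_card => w; rewrite !inE.
apply: le_trans leF _; rewrite ler_nat; apply: leq_alpha.
exact: admissible_linear_forest.
Qed.

(** The inequality for [d = 3] is the decisive one: [f_eps eps 3 = 3 * eps]
    leaves no room for an increase at degree one. *)
Lemma f_eps_extremal eps : 0 <= eps <= 1 / 6 ->
  extremal linear_forest (f_eps eps).
Proof.
move=> eps_b; split; first exact: f_eps_lower_bound.
case/andP: eps_b => e0 e6 [g [g01 [d gd] lbg]].
have g_ge0 k : 0 <= g k by case/andP: (g01 k).
suff g0 : forall k, g k <= 0 by apply: gd; apply/le_anti; rewrite g0 g_ge0.
have [fg01 _] := lbg; have cpl := lower_bound_complete lbg.
have clw := lower_bound_claws lbg.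
have g1 : g 1%N <= 0.
  have := clw 3%N isT; have := g_ge0 3%N; rewrite f_eps_ge3 //.
  have -> : Num.min (3 * eps) (2 / 4%:R) = 3 * eps by apply/min_idPl; lra.
  rewrite /f_eps /=; lra.
case=> [|[|[|k]]] //.
- by have /andP[_] := fg01 0%N; rewrite /f_eps /=; lra.
- by have := cpl 2%N; rewrite /f_eps /=; lra.
have h1 := cpl k.+3; have h2 := clw k.+3 isT; have h3 := g_ge0 1%N.
move: h1 h2; rewrite f_eps_ge3 //.
by move: (2 / k.+4%:R) => t; case: (leP (3 * eps) t) => _; rewrite /f_eps /=; lra.
Qed.

Lemma lower_bound_dominated f : lower_bound linear_forest f ->
  exists eps : R, 0 <= eps <= 1 / 6 /\ dominated f (f_eps eps).
Proof.
move=> lbf; have [f01 _] := lbf; have cpl := lower_bound_complete lbf.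
have clw := lower_bound_claws lbf.
have /andP[_ f1] := f01 1%N; have /andP[_ f0] := f01 0%N.
(* If [1 / 6 <= 1 - f 1], then [eps = 1 / 6], and the minimum in [f_eps] is
   [2 / d.+1] for all [3 <= d]. *)
exists (Num.min (1 - f 1%N) (1 / 6)); split.
  by rewrite le_min ge_min lexx orbT andbT; apply/andP; split; lra.
have min1 : Num.min (1 - f 1%N) (1 / 6) <= 1 - f 1%N by rewrite ge_min lexx.
case=> [|[|[|d]]].
- by rewrite /f_eps.
- by rewrite /f_eps /=; lra.
- by have := cpl 2%N; rewrite /f_eps /=; lra.
rewrite f_eps_ge3 // le_min cpl andbT.
case: (leP (1 - f 1%N) (1 / 6)) => _; first by have := clw d.+3 isT; lra.
apply: le_trans (cpl d.+3) _; rewrite ler_pdivrMr ?ltr0n //.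
have : 4 <= d.+4%:R :> R by rewrite (ler_nat R 4).
by move: (d.+4%:R) => x; lra.
Qed.

End Bounds.

Theorem theorem6 (R : realType) :
  (forall eps : R, 0 <= eps <= 1 / 6 ->
     lower_bound linear_forest (f_eps eps) /\
     extremal linear_forest (f_eps eps)) /\
  (forall f : nat -> R, lower_bound linear_forest f ->
     exists eps : R, 0 <= eps <= 1 / 6 /\ dominated f (f_eps eps)).
Proof.
split=> [eps eps_b|f]; last exact: lower_bound_dominated.
by split; [exact: f_eps_lower_bound | exact: f_eps_extremal].
Qed.
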